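(* Let $M$ be an irreducible rational homology sphere of dimension $3$. Any taut, transversely oriented codimension one foliation of $M$ has no compact leaf.
   Context: A rational homology sphere is a closed connected orientable $3$-manifold $M$ with $H_*(M;\mathbb{Q})\cong H_*(\mathbb{S}^3;\mathbb{Q})$. Transversely oriented: a nowhere zero continuous vector field on $M$ transverse to all leaves is fixed. Taut (closed manifold): for every leaf $F$ of the foliation there is an embedded loop in $M$ which meets $F$ and is transverse to every leaf it meets. *)

(* Defs.v *)
From HB Require Import structures.
From Stdlib Require Import Relation_Operators.
From mathcomp Require Import all_boot all_order all_algebra.
From mathcomp Require Import all_classical all_reals all_analysis.
From mathcomp Require Import freeg.

Set Implicit Arguments.
Unset Strict Implicit.
Unset Printing Implicit Defensive.

Import Order.TTheory GRing.Theory Num.Theory numFieldNormedType.Exports.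

Local Open Scope classical_set_scope.
Local Open Scope ring_scope.

Section Simplex.
Context (R : realType).

Definition simplex (n : nat) : set 'rV[R]_n.+1 :=
  [set x | (forall i, 0 <= x 0 i) /\ \sum_i x 0 i = 1].
Arguments simplex n : clear implicits.

Definition face_row n (i : 'I_n.+2) (x : 'rV[R]_n.+1) : 'rV[R]_n.+2 :=
  \row_j (if unlift i j is Some k then x 0 k else 0).

Fact face_row_simplex n (i : 'I_n.+2) x :
  simplex n x -> simplex n.+1 (face_row i x).
Proof.
move=> [x0 x1]; split=> [j|]; first by rewrite mxE; case: unlift.
rewrite (bigD1_ord i) //= mxE unlift_none add0r -x1.
by apply: eq_bigr => j _; rewrite mxE liftK.
Qed.

Definition face n (i : 'I_n.+2) (x : simplex n) : simplex n.+1 :=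
  exist _ (face_row i (set_val x))
    (mem_set (face_row_simplex i (set_valP x))).

Fact face_row_continuous n (i : 'I_n.+2) : continuous (@face_row n i).
Proof.
move=> x s /= /nbhs_ballP[e /= e0 es]; apply/nbhs_ballP; exists e => //= y [_ xy].
apply: es; split=> // a b; rewrite !mxE.
by case: unlift => [k|]; [exact: xy | exact: ballxx].
Qed.

Fact face_continuous n (i : 'I_n.+2) : continuous (@face n i).
Proof.
apply: continuous_comp_initial => x.
apply: (@continuous_comp _ _ _ set_val (face_row i)).
  exact: initial_continuous.
exact: face_row_continuous.
Qed.

End Simplex.
Arguments simplex : clear implicits.

Section Homology.
Context (R : realType) (T : topologicalType).

Definition singular (n : nat) := set_type [set s : simplex R n -> T | continuous s].

Definition chain (n : nat) := {freeg (singular n) / rat}.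

Fact singular_face_subproof n (i : 'I_n.+2) (s : singular n.+1) :
  (set_val s \o face i) \in [set s : simplex R n -> T | continuous s].
Proof.
apply/mem_set => x; apply: continuous_comp; first exact: face_continuous.
exact: (set_valP s).
Qed.

Definition singular_face n (i : 'I_n.+2) (s : singular n.+1) : singular n :=
  exist _ (set_val s \o face i) (singular_face_subproof i s).

Definition boundary n : chain n.+1 -> chain n :=
  fglift (fun s => \sum_(i < n.+2) (-1) ^+ i *: << singular_face i s >>).

Fact boundary_linear n : linear (@boundary n).
Proof.
have [b bE] : exists b : {additive chain n.+1 -> chain n}, b =1 @boundary n.
  have badd : zmod_morphism (@boundary n) by exact: lift_is_additive.
  pose bM := GRing.isZmodMorphism.Build _ _ _ badd.
  pose b : {additive chain n.+1 -> chain n} := HB.pack (@boundary n) bM.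
  by exists b.
have bU k s : b << k *g s >> = k *: b << s >>.
  by rewrite !bE /boundary !liftU scale1r.
suff bZ a (c : chain n.+1) : b (a *: c) = a *: b c.
  by move=> a c d; rewrite -!bE raddfD bZ.
have -> : a *: c = \sum_(s <- dom c) << a * coeff s c *g s >>.
  rewrite -[in LHS](freeg_sumE c) scaler_sumr; apply: eq_bigr => s _.
  by apply/eqP/freeg_eqP => t; rewrite coeffZ !coeffU mulrA.
rewrite -[in RHS](freeg_sumE c) !raddf_sum; apply: eq_bigr => s _ /=.
by rewrite (bU (a * _)) (bU (coeff _ _)) scalerA.
Qed.
HB.instance Definition _ n :=
  GRing.isLinear.Build rat (chain n.+1) (chain n) _ (@boundary n)
    (@boundary_linear n).

Definition is_cycle n : chain n -> bool :=
  if n is m.+1 then fun c : chain m.+1 => boundary c == 0 else fun=> true.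

Fact is_cycle_submod_closed n : submod_closed (@is_cycle n).
Proof.
case: n => [|n]; split=> //=; first by rewrite unfold_in /= linear0.
move=> a u v; rewrite !unfold_in /= => /eqP u0 /eqP v0.
by rewrite linearP /= u0 v0 scaler0 addr0.
Qed.
HB.instance Definition _ n :=
  GRing.isSubmodClosed.Build rat (chain n) (@is_cycle n)
    (@is_cycle_submod_closed n).

Record cycle n := Cycle { cycle_chain :> chain n; _ : cycle_chain \in @is_cycle n }.
HB.instance Definition _ n := [isSub for @cycle_chain n].
HB.instance Definition _ n := [Choice of cycle n by <:].
HB.instance Definition _ n := [SubChoice_isSubZmodule of cycle n by <:].
HB.instance Definition _ n := [SubZmodule_isSubLmodule of cycle n by <:].

Definition is_boundary n : pred (cycle n) :=
  fun c => `[< exists d : chain n.+1, boundary d = c >].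

Fact is_boundary_submod_closed n : submod_closed (@is_boundary n).
Proof.
split=> [|a u v]; rewrite !unfold_in.
  by apply/asboolP; exists 0; rewrite linear0.
move=> /asboolP[d du] /asboolP[e ev]; apply/asboolP; exists (a *: d + e).
by rewrite linearP /= du ev.
Qed.
HB.instance Definition _ n :=
  GRing.isSubmodClosed.Build rat (cycle n) (@is_boundary n)
    (@is_boundary_submod_closed n).

Definition boundaries n : zmodClosed (cycle n) :=
  GRing.ZmodClosed.clone (cycle n) (@is_boundary n) _.

Definition homology (n : nat) : Type := Quotient.quot (boundaries n).
HB.instance Definition _ n :=
  GRing.Zmodule.copy (homology n) (Quotient.quot (boundaries n)).

Definition homology_class n (c : cycle n) : homology n :=
  \pi_(Quotient.quot (boundaries n))%qT c.

Definition homology_scale n (a : rat) (h : homology n) : homology n :=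
  homology_class (a *: repr (h : Quotient.quot (boundaries n))).

Lemma homology_classP n (c d : cycle n) :
  homology_class c = homology_class d <-> is_boundary (c - d).
Proof.
rewrite -[is_boundary _]/(c - d \in boundaries n) Quotient.idealrBE.
by split=> [h|/eqP //]; apply/eqP.
Qed.

Lemma homology_ind n (P : homology n -> Prop) :
  (forall c, P (homology_class c)) -> forall h, P h.
Proof. by move=> Pc h; rewrite -[h]reprK; exact: Pc. Qed.

Lemma homology_classD n : {morph @homology_class n : c d / c + d}.
Proof. by move=> c d; exact: (Quotient.pi_add (boundaries n)). Qed.

Lemma homology_classZ n a (c : cycle n) :
  homology_scale a (homology_class c) = homology_class (a *: c).
Proof.
apply/homology_classP; rewrite -scalerBr; apply: (rpredZ a).
by apply/homology_classP; exact: reprK.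
Qed.

Fact homology_scalerA n a b (h : homology n) :
  homology_scale a (homology_scale b h) = homology_scale (a * b) h.
Proof. by elim/homology_ind: h => c; rewrite !homology_classZ scalerA. Qed.

Fact homology_scale1r n : left_id 1 (@homology_scale n).
Proof. by elim/homology_ind => c; rewrite homology_classZ scale1r. Qed.

Fact homology_scalerDr n : right_distributive (@homology_scale n) +%R.
Proof.
move=> a; elim/homology_ind => c; elim/homology_ind => d.
by rewrite -homology_classD !homology_classZ -homology_classD scalerDr.
Qed.

Fact homology_scalerDl n (h : homology n) :
  {morph (@homology_scale n)^~ h : a b / a + b}.
Proof.
elim/homology_ind: h => c a b.
by rewrite !homology_classZ -homology_classD scalerDl.
Qed.

HB.instance Definition _ n :=
  GRing.Zmodule_isLmodule.Build rat (homology n) (@homology_scalerA n)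
    (@homology_scale1r n) (@homology_scalerDr n) (@homology_scalerDl n).

End Homology.

Section Smooth.
Context {R : realType} {m n : nat}.

(* [U] is meant to be open. *)
Fixpoint Ck_on (k : nat) (U : set 'rV[R]_m) (f : 'rV[R]_m -> 'rV[R]_n) : Prop :=
  match k with
  | 0 => forall x, U x -> {for x, continuous f}
  | k'.+1 => (forall x, U x -> differentiable f x) /\
             forall v, Ck_on k' U ('D_v f)
  end.

Definition smooth_on (U : set 'rV[R]_m) (f : 'rV[R]_m -> 'rV[R]_n) : Prop :=
  forall k, Ck_on k U f.

End Smooth.

(* The values of [cmap] outside [cdom], and of [cinv] outside [ccod], are
   irrelevant. *)
Record chart (R : realType) (T : Type) := Chart {
  cdom : set T;
  ccod : set 'rV[R]_3;
  cmap : T -> 'rV[R]_3;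
  cinv : 'rV[R]_3 -> T }.

Section Charts.
Context {R : realType} {T : topologicalType}.
Implicit Types c : chart R T.

Definition is_chart c : Prop :=
  [/\ open (cdom c) /\ open (ccod c),
      forall p, cdom c p -> ccod c (cmap c p) /\ cinv c (cmap c p) = p,
      forall x, ccod c x -> cdom c (cinv c x) /\ cmap c (cinv c x) = x,
      forall p, cdom c p -> {for p, continuous (cmap c)} &
      forall x, ccod c x -> {for x, continuous (cinv c)}].

Definition covers (A : set (chart R T)) : Prop :=
  forall p, exists2 c, A c & cdom c p.

Definition transition c c' : 'rV[R]_3 -> 'rV[R]_3 := cmap c' \o cinv c.

Definition transition_dom c c' : set 'rV[R]_3 :=
  ccod c `&` cinv c @^-1` cdom c'.

Definition smoothly_compatible c c' : Prop :=
  smooth_on (transition_dom c c') (transition c c').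

End Charts.

Record manifold3 (R : realType) := Manifold3 {
  carrier :> topologicalType;
  atlas : set (chart R carrier);
  manifold_hausdorff : hausdorff_space carrier;
  manifold_second_countable : @second_countable carrier;
  atlas_chart : forall c, atlas c -> is_chart c;
  atlas_covers : covers atlas;
  atlas_smooth : forall c c', atlas c -> atlas c' -> smoothly_compatible c c' }.

Section Manifold.
Context {R : realType} (M : manifold3 R).

Definition orientable : Prop :=
  exists A : set (chart R M),
    [/\ forall c, A c -> is_chart c,
        forall c c', A c -> atlas c' ->
          smoothly_compatible c c' /\ smoothly_compatible c' c,
        covers A &
        forall c c', A c -> A c' -> forall x, transition_dom c c' x ->
          0 < \det (jacobian (transition c c') x)].

Definition smooth_map_on (U : set 'rV[R]_3) (f : 'rV[R]_3 -> M) : Prop :=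
  (forall x, U x -> {for x, continuous f}) /\
  forall c, atlas c -> smooth_on (U `&` f @^-1` cdom c) (cmap c \o f).

(* A smooth embedding into [M] of a compact submanifold [K] of R^3 whose tangent
   space at [x] is [TK x]; a map is smooth on [K] when it is the restriction of
   a map that is smooth on an open neighbourhood of [K]. *)
Definition smooth_embedding (K : set 'rV[R]_3)
    (TK : 'rV[R]_3 -> set 'rV[R]_3) (f : 'rV[R]_3 -> M) : Prop :=
  [/\ exists U, [/\ open U, K `<=` U & smooth_map_on U f],
      set_inj K f &
      forall c x v, atlas c -> K x -> cdom c (f x) -> TK x v ->
        'd (cmap c \o f) x v = 0 -> v = 0].

End Manifold.

Section SpheresAndBalls.
Context (R : realType).

(* Euclidean, while the library norm on row vectors is the sup norm. *)
Definition dotprod n (x y : 'rV[R]_n) : R := \sum_i x 0 i * y 0 i.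

Definition unit_sphere n : set 'rV[R]_n.+1 := [set x | dotprod x x = 1].

Definition unit_ball n : set 'rV[R]_n := [set x | dotprod x x <= 1].

Definition embedded_sphere (M : manifold3 R) (S : set M) : Prop :=
  exists f : 'rV[R]_3 -> M,
    smooth_embedding (@unit_sphere 2) (fun x => [set v | dotprod x v = 0]) f /\
    S = f @` @unit_sphere 2.

Definition bounds_ball (M : manifold3 R) (S : set M) : Prop :=
  exists f : 'rV[R]_3 -> M,
    smooth_embedding (@unit_ball 3) (fun=> setT) f /\ S = f @` @unit_sphere 2.

Definition irreducible (M : manifold3 R) : Prop :=
  forall S : set M, embedded_sphere S -> bounds_ball S.

Definition rational_homology_sphere (M : manifold3 R) : Prop :=
  [/\ compact [set: M], connected [set: M], orientable M &
      forall n, exists f : {linear homology R M n ->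
                              homology R (set_type (@unit_sphere 3)) n},
        bijective f].

End SpheresAndBalls.

Section Tangent.
Context {R : realType} {M : manifold3 R}.

(* A tangent vector at [p] is given by its coordinates in all charts of the
   atlas around [p]. *)
Definition tangent_vector (p : M) (v : chart R M -> 'rV[R]_3) : Prop :=
  forall c c', atlas c -> atlas c' -> cdom c p -> cdom c' p ->
    v c' = 'd (transition c c') (cmap c p) (v c).

Definition continuous_vector_field (X : M -> chart R M -> 'rV[R]_3) : Prop :=
  (forall p, tangent_vector p (X p)) /\
  forall c, atlas c -> forall p, cdom c p -> {for p, continuous (X^~ c)}.

Definition nowhere_zero (X : M -> chart R M -> 'rV[R]_3) : Prop :=
  forall p c, atlas c -> cdom c p -> X p c != 0.

Definition velocity (g : R -> M) (t : R) (c : chart R M) : 'rV[R]_3 :=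
  derive1 (cmap c \o g) t.

Definition C1_path (g : R -> M) : Prop :=
  continuous g /\
  forall c t, atlas c -> cdom c (g t) ->
    derivable (cmap c \o g) t 1 /\ {for t, continuous (fun s => velocity g s c)}.

End Tangent.

Section Foliations.
Context {R : realType}.

(* Foliated charts are onto R^3 = R^2 x R; the plaques are the level sets of the
   last coordinate. *)
Definition height (T : Type) (c : chart R T) (p : T) : R := cmap c p 0 ord_max.

Definition plaque (T : Type) (c : chart R T) (z : R) : set T :=
  [set p | cdom c p /\ height c p = z].

Definition leaf_direction (T : topologicalType) (b c : chart R T) (i : 'I_3)
  (x : 'rV[R]_3) : 'rV[R]_3 := 'D_(delta_mx 0 i) (transition b c) x.

Definition e0 : 'I_3 := inord 0.
Definition e1 : 'I_3 := inord 1.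

(* No transverse regularity is assumed beyond continuity: the leaves are C^1
   immersed surfaces whose tangent planes vary continuously. *)
Record foliation (M : manifold3 R) := Foliation {
  fol_atlas : set (chart R M);
  fol_chart : forall b, fol_atlas b -> is_chart b /\ ccod b = setT;
  fol_covers : covers fol_atlas;
  fol_coherent : forall b b' p, fol_atlas b -> fol_atlas b' ->
    cdom b p -> cdom b' p ->
    exists2 W, nbhs p W & forall q q', W q -> W q' ->
      height b q = height b q' -> height b' q = height b' q';
  fol_C1 : forall b c x, fol_atlas b -> atlas c -> transition_dom b c x ->
    (forall i, i = e0 \/ i = e1 ->
       derivable (transition b c) x (delta_mx 0 i) /\
       {for x, continuous (leaf_direction b c i)}) /\
    (forall s t, s *: leaf_direction b c e0 x + t *: leaf_direction b c e1 x = 0 ->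
       s = 0 /\ t = 0) }.

Context {M : manifold3 R} (F : foliation M).

Definition same_plaque (p q : M) : Prop :=
  exists b z, [/\ fol_atlas F b, plaque b z p & plaque b z q].

Definition leaf (p : M) : set M := clos_refl_trans M same_plaque p.

(* Coordinates in the chart [c] of the tangent plane at [p] of the leaf of [p]. *)
Definition leaf_tangent_plane (p : M) (c : chart R M) : set 'rV[R]_3 :=
  [set v | exists b, [/\ fol_atlas F b, cdom b p &
     exists s t, v = s *: leaf_direction b c e0 (cmap b p)
                   + t *: leaf_direction b c e1 (cmap b p)]].

Definition transverse_at (p : M) (v : chart R M -> 'rV[R]_3) : Prop :=
  forall c, atlas c -> cdom c p -> ~ leaf_tangent_plane p c (v c).

Definition transverse_orientation (X : M -> chart R M -> 'rV[R]_3) : Prop :=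
  [/\ continuous_vector_field X, nowhere_zero X & forall p, transverse_at p (X p)].

(* A loop R/Z -> M is a 1-periodic map on R. *)
Definition embedded_transverse_loop (g : R -> M) : Prop :=
  [/\ forall t, g (t + 1) = g t,
      forall s t, g s = g t -> s - t \is a Num.int,
      C1_path g &
      forall t, transverse_at (g t) (velocity g t)].

Definition taut : Prop :=
  forall p, exists2 g, embedded_transverse_loop g & exists t, leaf p (g t).

(* [M] with the leaf topology, in which the leaves are the connected components
   and the plaques are open. *)
Definition leafwise of foliation M : Type := M.
HB.instance Definition _ := Choice.copy (leafwise F) M.

Definition leafwise_open (A : set (leafwise F)) : Prop :=
  forall b z, fol_atlas F b ->
    exists2 V : set M, open V & forall p, plaque b z p -> (A p <-> V p).

Fact leafwise_openT : leafwise_open setT.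
Proof. by move=> b z _; exists setT; first exact: openT. Qed.

Fact leafwise_openI : setI_closed leafwise_open.
Proof.
move=> A B oA oB b z Fb; have [V oV AV] := oA b z Fb; have [W oW BW] := oB b z Fb.
exists (V `&` W) => [|p bp]; first exact: openI.
by split=> -[/(AV p bp) ? /(BW p bp)].
Qed.

Fact leafwise_open_bigU (I : Type) (A : I -> set (leafwise F)) :
  (forall i, leafwise_open (A i)) -> leafwise_open (\bigcup_i A i).
Proof.
move=> oA b z Fb; have /choice[V VP] i : exists V : set M,
    open V /\ forall p, plaque b z p -> (A i p <-> V p).
  by have [V oV AV] := oA i b z Fb; exists V.
exists (\bigcup_i V i) => [|p bp].
  by apply: bigcup_open => i _; have [] := VP i.
by split=> -[i _ pi]; exists i => //; have [_ /(_ p bp)[]] := VP i; auto.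
Qed.

HB.instance Definition _ := isOpenTopological.Build (leafwise F)
  leafwise_openT leafwise_openI leafwise_open_bigU.

Definition compact_leaf (L : set M) : Prop :=
  (exists p, L = leaf p) /\ compact (L : set (leafwise F)).

End Foliations.

(* Main.v *)
(* A transverse loop through a compact leaf L always crosses L in the direction
   of X, so its intersection number with L is non-zero.  As L is closed and
   locally separates M into two sides, which X distinguishes, this number is the
   value of a linear form on H_1(M; Q); but H_1(M; Q) is H_1(S^3; Q) = 0.

   The linear form is obtained from a germ of cocycle [k x y], the change of
   the side of L from [x] to a nearby [y], by integrating along paths.  Since the
   foliation is only continuous in the transverse direction, sides are defined
   with the heights of foliated charts, and the link with the direction of X is
   that a vector transverse to the leaves cannot join two nearby points of a
   plaque. *)
From HB Require Import structures.
From Stdlib Require Import Relation_Operators.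
From mathcomp Require Import all_boot all_order all_algebra all_fingroup.
From mathcomp Require Import all_classical all_reals all_analysis.
From mathcomp Require Import freeg ring lra.
Require Import Defs.

Set Implicit Arguments.
Unset Strict Implicit.
Unset Printing Implicit Defensive.

Import Order.TTheory GRing.Theory Num.Theory numFieldNormedType.Exports.

Local Open Scope classical_set_scope.
Local Open Scope ring_scope.

(** * Cocycles of germs and their primitives *)

(** Singular simplices are merely continuous and may meet L in a wild closed set, so their
    intersections with L cannot be counted. Integrating a germ requires no general position: all
    that is used of [crossing] is a cocycle identity in which each neighbourhood may depend on the
    previous point, and primitives along a path or over a square are then built by connectedness.
    The same device avoids counting the crossings of the loop: up to a global sign the primitive
    along it is monotone, and it jumps at a point of L. Compactness of L is compactness in the leaf
    topology. It gives that L is closed and that near each of its points L is a single plaque; a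
    leaf accumulating on itself would break the cocycle identity. The homology hypothesis is an
    abstract isomorphism with the homology of S^3, so the vanishing of H_1(S^3; Q) has to be proved
    as well: a path is cut into pieces that avoid the antipode of one of two reference points, and
    each piece is coned off. *)

Lemma connected_ind (T : topologicalType) (A : set T) (P : T -> Prop) :
  connected A ->
  (forall x, A x -> \forall y \near x, A y -> (P x <-> P y)) ->
  forall x y, A x -> A y -> P x -> P y.
Proof.
move=> cA loc x y Ax Ay Px.
have op (Q : T -> Prop) : (forall z, A z -> Q z -> \forall t \near z, A t -> Q t) ->
    exists2 C, open C & A `&` Q = A `&` C.
  move=> Qloc; exists (interior [set t | A t -> Q t]); first exact: open_interior.
  apply/seteqP; split=> z [Az Qz]; split=> //; first exact: Qloc.
  exact: (nbhs_singleton Qz).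
suff /seteqP[_ /(_ y Ay)[]] : A `&` P = A by [].
apply: cA; first by exists x.
- have [|C oC ->] := op P; last by exists C.
  move=> z Az Pz; apply: filterS (loc z Az) => t zt At; exact/(zt At).
- have [|C oC E] := op (fun t => ~ P t).
    move=> z Az Pz; apply: filterS (loc z Az) => t zt At Pt; exact/Pz/(zt At).
  exists (~` C); first exact: open_closedC.
  apply/seteqP; split=> z [Az Qz]; split=> //.
    move=> Cz; have : (A `&` C) z by [].
    by rewrite -E => -[].
  apply: contrapT => nP; apply: Qz.
  by have : (A `&` (fun t => ~ P t)) z by []; rewrite E => -[].
Qed.

Lemma segment_ind (R : realType) (P : R -> Prop) (a b : R) : a <= b ->
  (forall x, a <= x -> x <= b -> \forall y \near x, a <= y -> y <= b -> (P x <-> P y)) ->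
  P a -> P b.
Proof.
move=> ab loc; apply: (@connected_ind R `[a, b]%classic) => /=.
- exact: segment_connected.
- move=> x; rewrite in_itv /= => /andP[ax xb]; apply: filterS (loc x ax xb) => y h.
  by rewrite in_itv /= => /andP[]; exact: h.
- by rewrite in_itv /= lexx ab.
- by rewrite in_itv /= lexx ab.
Qed.

Lemma pair_continuousr (U V : topologicalType) (a : U) : continuous (fun b : V => (a, b)).
Proof.
move=> b P [[A B] [/= Aa Bb] AB]; apply: filterS Bb => t Bt.
by apply: AB; split=> //=; exact: nbhs_singleton.
Qed.

Lemma pair_continuousl (U V : topologicalType) (b : V) : continuous (fun a : U => (a, b)).
Proof.
move=> a P [[A B] [/= Aa Bb] AB]; apply: filterS Aa => t At.
by apply: AB; split=> //=; exact: nbhs_singleton.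
Qed.

Section Cocycle.
Context (T : topologicalType) (k : T -> T -> rat).

(** The neighbourhood in which [x] ranges depends on [x1]. A uniform one would be too strong for
    [crossing]: if [x0] is on the leaf and [x1] is close to it but off the leaf, then
    [crossing x1 x] vanishes and the identity fails once [x] is on the other side. *)
Definition cocycle :=
  forall x0, \forall x1 \near x0, \forall x \near x1, k x0 x = k x0 x1 + k x1 x.

Definition primitive (S : topologicalType) (u : S -> T) (A : set S) (F : S -> rat) :=
  forall t0, A t0 -> \forall t \near t0, A t -> F t = F t0 + k (u t0) (u t).

Hypothesis kK : cocycle.

Lemma cocyclexx x : k x x = 0.
Proof.
have := nbhs_singleton (nbhs_singleton (kK x)).
by move=> h; apply: (addrI (k x x)); rewrite -h addr0.
Qed.

Lemma cocycle_pullback (S : topologicalType) (u : S -> T) : continuous u ->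
  forall t0, \forall t1 \near t0, \forall t \near t1,
    k (u t0) (u t) = k (u t0) (u t1) + k (u t1) (u t).
Proof.
move=> cu t0.
have : nbhs t0 [set t1 | \forall x \near u t1, k (u t0) x = k (u t0) (u t1) + k (u t1) x].
  exact: (cu t0 _ (kK (u t0))).
by apply: filterS => t1 h; exact: (cu t1 _ h).
Qed.

(** The difference of two primitives is locally constant. *)
Lemma primitive_unique (S : topologicalType) (u : S -> T) A F G :
  connected A -> primitive u A F -> primitive u A G ->
  forall x y, A x -> A y -> F y - F x = G y - G x.
Proof.
move=> cA pF pG x y Ax Ay.
apply: (@connected_ind _ A (fun z => F z - F x = G z - G x) cA _ x y) => //;
  last by rewrite !subrr.
move=> z Az; near=> t => At.
have -> : F t = F z + k (u z) (u t) by move: At; near: t; exact: pF.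
have -> : G t = G z + k (u z) (u t) by move: At; near: t; exact: pG.
by rewrite ![_ + k _ _ - _]addrAC; split=> [->//|/addIr].
Unshelve. all: by end_near. Qed.

Lemma primitive_comp (S S' : topologicalType) (u : S -> T) (v : S' -> S) A A' F :
  continuous v -> (forall t, A' t -> A (v t)) ->
  primitive u A F -> primitive (u \o v) A' (F \o v).
Proof.
move=> cv vA pF t0 At0.
have : nbhs t0 [set t | A (v t) -> F (v t) = F (v t0) + k (u (v t0)) (u (v t))].
  exact: (cv t0 _ (pF _ (vA _ At0))).
by apply: filterS => t h /vA.
Qed.

End Cocycle.

Section CocycleReal.
Context (R : realType) (T : topologicalType) (k : T -> T -> rat).
Hypothesis kK : cocycle k.

Lemma primitive_exists (u : R -> T) : continuous u ->
  exists F, primitive k u `[0, 1] F.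
Proof.
move=> cu; pose P c := exists F, primitive k u `[0, c] F.
suff : P 1 by [].
apply: (@segment_ind _ P 0 1) => //; last first.
  exists (fun=> 0) => t0 /=; rewrite in_itv /= => /le_anti <-.
  by near=> t => /[!in_itv] /= /le_anti <-; rewrite (cocyclexx kK) addr0.
move=> c0 _ _; have /nbhs_ballP[e /= e0 eb] := cocycle_pullback kK cu c0.
suff PP c c' : ball c0 e c -> ball c0 e c' -> P c -> P c'.
  near=> c => _ _; have c0c : ball c0 e c by near: c; exact: nbhsx_ballx.
  have c00 : ball c0 e c0 by exact: ballxx.
  by split; exact: PP.
move=> bc bc' [F pF]; have [cc'|cc'] := leP c' c.
  exists F => t0 /=; rewrite in_itv /= => /andP[t00 t0c].
  have : `[0, c]%classic t0 by rewrite /= in_itv /= t00 (le_trans t0c).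
  move=> /pF; apply: filterS => t h; rewrite in_itv /= => /andP[? tc]; apply: h.
  by rewrite /= in_itv /=; apply/andP; split=> //; apply: le_trans cc'.
(* By the cocycle identity [K] is a primitive on the whole ball around [c0]; shifted by a constant,
   it prolongs [F] beyond [c]. *)
pose K t := k (u c0) (u t).
exists (fun t => if t <= c then F t else F c + (K t - K c)) => t0 /=.
rewrite in_itv /= => /andP[t00 t0c'].
have [tc|tc|->] := ltgtP t0 c.
- have : `[0, c]%classic t0 by rewrite /= in_itv /= t00 ltW.
  move=> /pF pt0; near=> t; rewrite in_itv /= => /andP[t0' _].
  have tc' : t < c by near: t; exact: lt_nbhsl.
  rewrite ltW //; have : `[0, c]%classic t by rewrite /= in_itv /= t0' ltW.
  by near: t.
- have bt : ball c0 e t0.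
    move: bc bc'; rewrite /ball /= !ltr_norml => /andP[h1 h2] /andP[h3 h4].
    by apply/andP; split; lra.
  have /= loc := eb _ bt; near=> t => _.
  have -> : t <= c = false by apply/negbTE; rewrite -ltNge; near: t; exact: lt_nbhsr.
  have -> : K t = K t0 + k (u t0) (u t) by near: t.
  by rewrite -!addrA; congr (_ + (_ + _)); rewrite addrC.
- have /= loc := eb _ bc; have [c0'|c0'] := leP 0 c; last first.
    near=> t; rewrite in_itv /= => /andP[t0' _]; exfalso.
    have : t < 0 by near: t; exact: lt_nbhsl.
    by rewrite ltNge t0'.
  have pc : \forall t \near c, `[0, c]%classic t -> F t = F c + k (u c) (u t).
    by apply: pF; rewrite /= in_itv /= c0' lexx.
  near=> t; rewrite in_itv /= => /andP[t0' _].
  case: ifP => [tc''|_]; rewrite ?lexx.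
    have : `[0, c]%classic t by rewrite /= in_itv /= t0'.
    by near: t.
  have -> : K t = K c + k (u c) (u t) by near: t.
  by rewrite [K c + _]addrC addrK.
Unshelve. all: by end_near. Qed.

(** Along the vertical segment between [b0] and [b], both [F a] and the germ based at [(a0, b0)] are
    primitives, so their increments agree. The radius [e] serves all columns [a] near [a0], which
    allows neighbouring columns to be compared. *)
Lemma primitive_square_local (S : R * R -> T) (F : R -> R -> rat) (a0 b0 : R) :
  continuous S -> 0 <= b0 <= 1 ->
  (forall a : R, 0 <= a <= 1 -> primitive k (fun b => S (a, b)) `[0, 1] (F a)) ->
  exists2 e : R, 0 < e & forall a b : R, ball a0 e a -> ball b0 e b ->
    0 <= a <= 1 -> 0 <= b <= 1 ->
    F a b - F a b0 = k (S (a0, b0)) (S (a, b)) - k (S (a0, b0)) (S (a, b0)).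
Proof.
move=> cS b01 pF; have := cocycle_pullback kK cS (a0, b0).
move=> /nbhs_ballP[d /= d0 dAB]; exists d => // a b ba bb a01 b01'.
pose J : set R := `[Order.min b b0, Order.max b b0]%classic.
have Jd t : J t -> ball b0 d t /\ 0 <= t <= 1.
  rewrite /J /= in_itv /= ge_min le_max => /andP[h1 h2].
  move: bb b01 b01'; rewrite /ball /= !ltr_norml => /andP[h3 h4] /andP[h5 h6] /andP[h7 h8].
  by case/orP: h1 => h1; case/orP: h2 => h2; split; apply/andP; split; lra.
have cJ : connected J by exact: segment_connected.
have Jb : J b by rewrite /J /= in_itv /= ge_min le_max lexx.
have Jb0 : J b0 by rewrite /J /= in_itv /= ge_min le_max lexx !orbT.
apply: (@primitive_unique T k R (fun b => S (a, b)) J (F a)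
  (fun b => k (S (a0, b0)) (S (a, b)))) => //.
  move=> t0 /Jd[_ t01]; have : `[0, 1]%classic t0 by rewrite /= in_itv.
  move=> /(pF a a01); apply: filterS => t h /Jd[_ ?]; apply: h.
  by rewrite /= in_itv.
move=> t0 /Jd[bt0 t01].
have : nbhs (a, t0) [set z | k (S (a0, b0)) (S z) =
    k (S (a0, b0)) (S (a, t0)) + k (S (a, t0)) (S z)].
  by apply: (dAB (a, t0)); split.
move=> [[A' B'] /= [A'a B't0] AB']; apply: filterS B't0 => t B't _.
by apply: (AB' (a, t)); split=> //; exact: nbhs_singleton.
Qed.

(* Integrate along the bottom edge, then vertically: being a primitive near a
   vertical line propagates from its bottom point by connectedness. *)
Lemma primitive_square (S : R * R -> T) : continuous S ->
  exists F : R * R -> rat, primitive k S (`[0, 1] `*` `[0, 1]) F.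
Proof.
move=> cS.
have cSa a : continuous (fun b => S (a, b)).
  by move=> b; apply: (@continuous_comp _ _ _ (fun b => (a, b)) S); [exact: pair_continuousr | exact: cS].
have cSb b : continuous (fun a => S (a, b)).
  by move=> a; apply: (@continuous_comp _ _ _ (fun a => (a, b)) S); [exact: pair_continuousl | exact: cS].
have /choice[G pG] a := primitive_exists (cSa a).
have [H pH] := primitive_exists (cSb 0).
pose F (a b : R) := H a + (G a b - G a 0).
have pF (a : R) : 0 <= a <= 1 -> primitive k (fun b => S (a, b)) `[0, 1] (F a).
  move=> _ t0 t01; apply: filterS (pG a t0 t01) => t h t1; rewrite /F h //.
  by rewrite -!addrA; congr (_ + (_ + _)); rewrite addrC.
have F0 a : F a 0 = H a by rewrite /F subrr addr0.
have step (a0 b : R) : 0 <= a0 <= 1 -> 0 <= b <= 1 -> \forall a \near a0, 0 <= a <= 1 ->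
    F a b = F a0 b + k (S (a0, b)) (S (a, b)).
  move=> a01 /andP[b0 b1].
  pose P c := \forall a \near a0, 0 <= a <= 1 -> F a c = F a0 c + k (S (a0, c)) (S (a, c)).
  apply: (@segment_ind R P 0 b b0); last first.
    rewrite /P; have : `[0, 1]%classic a0 by rewrite /= in_itv.
    by move=> /pH; apply: filterS => a h a1; rewrite !F0 h //= in_itv.
  move=> b' b'0 b'b; have b'01 : 0 <= b' <= 1 by rewrite b'0 (le_trans b'b).
  have [e e0 loc] := primitive_square_local a0 cS b'01 pF.
  have /= loc2 := cocycle_pullback kK cS (a0, b').
  have : nbhs b' [set b2 | \forall z \near (a0, b2), k (S (a0, b')) (S z) =
      k (S (a0, b')) (S (a0, b2)) + k (S (a0, b2)) (S z)] by exact: (@pair_continuousr R R a0 b' _ loc2).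
  have : nbhs b' (ball b' e) by exact: nbhsx_ballx.
  apply: filterS2 => b2 eb2 h b20 b2b; have b201 : 0 <= b2 <= 1.
    by rewrite b20 (le_trans b2b).
  have {h} : nbhs a0 [set a | k (S (a0, b')) (S (a, b2)) =
      k (S (a0, b')) (S (a0, b2)) + k (S (a0, b2)) (S (a, b2))].
    exact: (@pair_continuousl R R b2 a0 _ h).
  have : nbhs a0 (ball a0 e) by exact: nbhsx_ballx.
  have a0e : ball a0 e a0 by exact: ballxx.
  (* The horizontal increments of [F] at the heights [b2] and [b'] differ by exactly what [k]
     prescribes, so the claim at either height implies the claim at the other. *)
  move=> h1 h2; have : \forall a \near a0, 0 <= a <= 1 ->
      F a b2 - F a b' - (F a0 b2 - F a0 b') =
      k (S (a0, b2)) (S (a, b2)) - k (S (a0, b')) (S (a, b')).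
    apply: filterS2 h1 h2 => a ea h a1; rewrite !loc // h (cocyclexx kK) subr0.
    by rewrite addrAC [k _ _ + k _ _]addrC addrK.
  have alg (x y z w p q : rat) : x - y - (z - w) = p - q -> (y = w + q <-> x = z + p).
    by move=> E; split=> h; lra.
  move=> h; split; apply: filterS2 h => a h h' a1;
    exact/(alg _ _ _ _ _ _ (h a1))/(h' a1).
exists (fun z => F z.1 z.2) => -[a0 b0] [/= ]; rewrite !in_itv /= => a01 b01.
have [e e0 loc] := primitive_square_local a0 cS b01 pF.
have st := step a0 b0 a01 b01.
near=> z => -[/=]; rewrite !in_itv /= => a1 b1.
have za : ball a0 e z.1.
  by near: z; exists (ball a0 e, setT) => [|[? ?] []] //=; split=> //=; [exact: nbhsx_ballx | exact: filterT].
have zb : ball b0 e z.2.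
  by near: z; exists (setT, ball b0 e) => [|[? ?] []] //=; split=> //=; [exact: filterT | exact: nbhsx_ballx].
have zs : F z.1 b0 = F a0 b0 + k (S (a0, b0)) (S (z.1, b0)).
  by move: a1; near: z; eexists (_, setT) => [|[? ?] []] //=; [split; [exact: st | exact: filterT] |].
have := loc _ _ za zb a1 b1; rewrite zs -surjective_pairing; lra.
Unshelve. all: by end_near. Qed.
End CocycleReal.

(** * The linear form on chains defined by a cocycle *)

Section FreeModule.
Context (K : choiceType) (V : lmodType rat).

Lemma freeg_linear_ext (f : K -> V) :
  exists L : {linear {freeg K / rat} -> V}, forall s, L << s >> = f s.
Proof.
pose g : {freeg K / rat} -> V := fglift f.
have gadd : zmod_morphism g by exact: lift_is_additive.
pose bM := GRing.isZmodMorphism.Build _ _ _ gadd.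
pose b : {additive {freeg K / rat} -> V} := HB.pack g bM.
have bU k s : g << k *g s >> = k *: f s by exact: liftU.
have bZ : scalable b.
  move=> a c.
  have -> : a *: c = \sum_(s <- dom c) << a * coeff s c *g s >>.
    rewrite -[in LHS](freeg_sumE c) scaler_sumr; apply: eq_bigr => s _.
    by apply/eqP/freeg_eqP => t; rewrite coeffZ !coeffU mulrA.
  rewrite -[in RHS](freeg_sumE c) !raddf_sum; apply: eq_bigr => s _ /=.
  by rewrite (bU (a * _)) (bU (coeff _ _)) scalerA.
pose bS := GRing.isScalable.Build _ _ _ _ b bZ.
pose L : {linear {freeg K / rat} -> V} := HB.pack (b : _ -> _) b bS.
by exists L => s; rewrite -[f s]scale1r; exact: bU.
Qed.

Lemma freeg_linearP (L1 L2 : {linear {freeg K / rat} -> V}) :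
  (forall s, L1 << s >> = L2 << s >>) -> L1 =1 L2.
Proof.
move=> E c.
have -> : c = \sum_(s <- dom c) coeff s c *: << s >>.
  rewrite -[LHS](freeg_sumE c); apply: eq_bigr => s _.
  by apply/eqP/freeg_eqP => t; rewrite coeffZ !coeffU mul1r.
by rewrite !linear_sum; apply: eq_bigr => s _; rewrite !linearZ_LR E.
Qed.

End FreeModule.

(** * Continuous parametrizations of the 1-simplex and the 2-simplex *)

Section Clamp.
Context {R : realType}.

Lemma continuous_rV (T : topologicalType) n (f : T -> 'rV[R]_n) :
  (forall j, continuous (fun x => f x 0 j)) -> continuous f.
Proof.
move=> cf x A /nbhs_ballP[e /= e0 eA].
have : \forall y \near x, forall j, ball (f x 0 j) e (f y 0 j).
  by apply: filter_forall => j; apply: (cf j x); exact: nbhsx_ballx.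
by apply: filterS => y h; apply: eA; split=> // i j; rewrite ord1.
Qed.

(** The retraction of the line onto [0, 1]. It turns parametrizations of simplices into continuous
    maps on all of [R] or [R * R]. *)
Definition clamp01 (t : R) : R := Num.min 1 (Num.max 0 t).

Lemma clamp01_itv t : 0 <= clamp01 t <= 1.
Proof. by rewrite /clamp01 le_min ler01 le_max lexx ge_min lexx. Qed.

Lemma clamp01_id t : 0 <= t <= 1 -> clamp01 t = t.
Proof. by move=> /andP[? ?]; rewrite /clamp01 max_r // min_r. Qed.

Lemma clamp01_continuous : continuous clamp01.
Proof.
move=> t; apply: (@continuous_min R R (cst 1) ((cst 0 : R -> R^o) \max id) t).
  exact: cvg_cst.
by apply: (@continuous_max R R (cst 0) id t); [exact: cvg_cst | exact: cvg_id].
Qed.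

End Clamp.

Section SimplexCoordinates.
Context {R : realType}.

Definition segment_row (t : R) : 'rV[R]_2 :=
  \row_j nth 0 [:: 1 - clamp01 t; clamp01 t] j.

Fact segment_row_simplex t : simplex R 1 (segment_row t).
Proof.
have /andP[t0 t1] := clamp01_itv t; split=> [i|].
  by rewrite mxE; case: i => [[|[|//]]] ? //=; rewrite subr_ge0.
by rewrite !big_ord_recl big_ord0 !mxE /= addr0 subrK.
Qed.

Definition segment_point (t : R) : simplex R 1 :=
  exist _ (segment_row t) (mem_set (segment_row_simplex t)).

Lemma segment_point_continuous : continuous segment_point.
Proof.
apply: continuous_comp_initial; apply: continuous_rV => j t.
rewrite [X in continuous_at _ X](_ : _ = fun t => nth 0 [:: 1 - clamp01 t; clamp01 t] j);
  last by apply/funext => s; rewrite /= mxE.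
case: j => [[|[|//]]] ? /=; last exact: clamp01_continuous.
by apply: continuousB; [exact: cst_continuous | exact: clamp01_continuous].
Qed.

(* Collapses the left edge of the unit square to the vertex 0; the bottom, top
   and right edges become the edges 01, 02 and 12. *)
Definition square_row (z : R * R) : 'rV[R]_3 :=
  \row_j nth 0 [:: 1 - clamp01 z.1; clamp01 z.1 * (1 - clamp01 z.2);
                   clamp01 z.1 * clamp01 z.2] j.

Fact square_row_simplex z : simplex R 2 (square_row z).
Proof.
have /andP[t0 t1] := clamp01_itv z.1; have /andP[s0 s1] := clamp01_itv z.2; split=> [i|].
  by rewrite mxE; case: i => [[|[|[|//]]]] ? //=; rewrite ?mulr_ge0 ?subr_ge0.
by rewrite !big_ord_recl big_ord0 !mxE /= addr0 -mulrDr subrK mulr1 subrK.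
Qed.

Definition square_point (z : R * R) : simplex R 2 :=
  exist _ (square_row z) (mem_set (square_row_simplex z)).

Lemma square_point_continuous : continuous square_point.
Proof.
apply: continuous_comp_initial; apply: continuous_rV => j z.
rewrite [X in continuous_at _ X](_ : _ = fun z => nth 0 [:: 1 - clamp01 z.1;
  clamp01 z.1 * (1 - clamp01 z.2); clamp01 z.1 * clamp01 z.2] j);
  last by apply/funext => s; rewrite /= mxE.
have c1 : {for z, continuous (fun z : R * R => clamp01 z.1)}.
  by apply: continuous_comp; [exact: cvg_fst | exact: clamp01_continuous].
have c2 : {for z, continuous (fun z : R * R => clamp01 z.2)}.
  by apply: continuous_comp; [exact: cvg_snd | exact: clamp01_continuous].
case: j => [[|[|[|//]]]] ? /=.
- by apply: cvgB => //; exact: cvg_cst.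
- by apply: cvgM => //; apply: cvgB => //; exact: cvg_cst.
- exact: cvgM.
Qed.

Lemma face_segment2 t : face ord_max (segment_point t) = square_point (t, 0).
Proof.
apply: val_inj; apply/rowP => j; rewrite /= mxE.
have c0 : clamp01 0 = 0 :> R by rewrite clamp01_id // lexx ler01.
case: unliftP => [k ->|->]; rewrite !mxE /= c0 ?mulr0 //.
by case: k => [[|[|//]]] ? //=; rewrite subr0 mulr1.
Qed.

Lemma face_segment1 t : face (fintype.lift ord0 ord0) (segment_point t) = square_point (t, 1).
Proof.
apply: val_inj; apply/rowP => j; rewrite /= mxE.
have c1 : clamp01 1 = 1 :> R by rewrite clamp01_id // lexx ler01.
case: unliftP => [k ->|->]; rewrite !mxE /= c1 ?subrr ?mulr0 //.
by case: k => [[|[|//]]] ? //=; rewrite mulr1.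
Qed.

Lemma face_segment0 t : face ord0 (segment_point t) = square_point (1, t).
Proof.
apply: val_inj; apply/rowP => j; rewrite /= mxE.
have c1 : clamp01 1 = 1 :> R by rewrite clamp01_id // lexx ler01.
case: unliftP => [k ->|->]; rewrite !mxE /= c1 ?subrr //.
by case: k => [[|[|//]]] ? //=; rewrite mul1r.
Qed.

Lemma square_point_left t : square_point (0, t) = square_point (0, 0).
Proof.
apply: val_inj; apply/rowP => j; rewrite !mxE /=.
have c0 : clamp01 0 = 0 :> R by rewrite clamp01_id // lexx ler01.
by rewrite c0 !mul0r.
Qed.

Fact vertex0_simplex n : simplex R n (\row_j (j == ord0)%:R).
Proof.
split=> [i|]; rewrite ?mxE //.
rewrite (bigD1 ord0) //= mxE eqxx big1 ?addr0 // => i /negbTE i0.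
by rewrite mxE i0.
Qed.

Definition vertex0 n : simplex R n :=
  exist _ (\row_j (j == ord0)%:R) (mem_set (vertex0_simplex n)).

Lemma face0_vertex0 : face ord0 (vertex0 0) = segment_point 1.
Proof.
apply: val_inj; apply/rowP => j; rewrite /= !mxE.
rewrite clamp01_id ?lexx ?ler01 //.
case: unliftP => [k ->|->] /=; last by rewrite subrr.
by rewrite mxE ord1.
Qed.

Lemma face1_vertex0 : face (fintype.lift ord0 ord0) (vertex0 0) = segment_point 0.
Proof.
apply: val_inj; apply/rowP => j; rewrite /= !mxE.
rewrite clamp01_id ?lexx ?ler01 //.
by case: unliftP => [k ->|->] //=; rewrite ?mxE ord1 // subr0.
Qed.

End SimplexCoordinates.

Definition singular_path (R : realType) (T : topologicalType)
  (s : singular R T 1) : R -> T := set_val s \o segment_point.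

Lemma singular_path_continuous (R : realType) (T : topologicalType)
  (s : singular R T 1) : continuous (singular_path s).
Proof.
move=> t; apply: continuous_comp; first exact: segment_point_continuous.
exact: (set_valP s).
Qed.

(** * Integration of a cocycle over singular 1-chains *)

Section Period.
Context (R : realType) (T : topologicalType) (k : T -> T -> rat).
Hypothesis kK : cocycle k.

(** The integral of [k] along [s]. For a cocycle it does not depend on the primitive, and the
    default 0 is never reached, by [primitive_exists]. *)
Definition period (s : singular R T 1) : rat :=
  xget 0 [set q | exists2 F, primitive k (singular_path s) `[0, 1] F & q = F 1 - F 0].

Lemma periodE s F : primitive k (singular_path s) `[0, 1] F -> period s = F 1 - F 0.
Proof.
move=> pF; rewrite /period; case: xgetP => [q -> [G pG ->]|/(_ (F 1 - F 0))[]]; last by exists F.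
by apply: (primitive_unique (@segment_connected R 0 1) pG pF);
  rewrite /= in_itv /= lexx ler01.
Qed.

(** A primitive over the square expresses the periods of the three faces by its values at the
    corners. The alternating sum leaves the increment along the left edge, which is 0 because that
    edge is collapsed to a point. *)
Lemma period_boundary (s : singular R T 2) :
  period (singular_face ord0 s) - period (singular_face (fintype.lift ord0 ord0) s)
    + period (singular_face ord_max s) = 0.
Proof.
pose S : R * R -> T := set_val s \o square_point.
have cS : continuous S.
  move=> t; apply: continuous_comp; first exact: square_point_continuous.
  exact: (set_valP s).
have [F pF] := primitive_square kK cS.
have I0 : `[0, 1]%classic (0 : R) by rewrite /= in_itv /= lexx ler01.
have I1 : `[0, 1]%classic (1 : R) by rewrite /= in_itv /= lexx ler01.
have pFr (a : R) : `[0, 1]%classic a -> primitive k (S \o (fun b => (a, b))) `[0, 1] (F \o (fun b => (a, b))).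
  move=> Ia; apply: (@primitive_comp T k (R * R)%type R S (fun b => (a, b))
    (`[0, 1] `*` `[0, 1])) => //.
  exact: pair_continuousr.
have pFl (b : R) : `[0, 1]%classic b -> primitive k (S \o (fun a => (a, b))) `[0, 1] (F \o (fun a => (a, b))).
  move=> Ib; apply: (@primitive_comp T k (R * R)%type R S (fun a => (a, b))
    (`[0, 1] `*` `[0, 1])) => //.
  exact: pair_continuousl.
have E0 : singular_path (singular_face ord0 s) = S \o (fun b => (1, b)).
  by apply/funext => t; rewrite /singular_path /S /= -face_segment0.
have E1 : singular_path (singular_face (fintype.lift ord0 ord0) s) = S \o (fun a => (a, 1)).
  by apply/funext => t; rewrite /singular_path /S /= -face_segment1.
have E2 : singular_path (singular_face ord_max s) = S \o (fun a => (a, 0)).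
  by apply/funext => t; rewrite /singular_path /S /= -face_segment2.
rewrite (@periodE (singular_face ord0 s) (F \o (fun b => (1, b)))) ?E0; last exact: pFr.
rewrite (@periodE (singular_face (fintype.lift ord0 ord0) s) (F \o (fun a => (a, 1)))) ?E1; last exact: pFl.
rewrite (@periodE (singular_face ord_max s) (F \o (fun a => (a, 0)))) ?E2; last exact: pFl.
have : F (0, 1) - F (0, 0) = 0 - 0.
  apply: (@primitive_unique _ k R (S \o (fun b => (0, b))) `[0, 1] (F \o (fun b => (0, b))) (fun=> 0)) => //.
  - exact: segment_connected.
  - exact: pFr.
  - move=> t0 _; near=> t => _; rewrite /S /= !(square_point_left t) (square_point_left t0).
    by rewrite (cocyclexx kK) addr0.
by rewrite /=; lra.
Unshelve. all: by end_near. Qed.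

Lemma period_linear : exists Phi : {linear chain R T 1 -> rat^o},
  (forall d : chain R T 2, Phi (boundary d) = 0) /\
  (forall s F, primitive k (singular_path s) `[0, 1] F -> Phi << s >> = F 1 - F 0).
Proof.
have [Phi PhiE] := freeg_linear_ext (period : singular R T 1 -> rat^o).
exists Phi; split=> [d|s F pF]; last by rewrite PhiE (periodE pF).
have [Z ZE] := freeg_linear_ext ((fun=> 0) : singular R T 2 -> rat^o).
have Z0 c : Z c = 0.
  pose N : {linear chain R T 2 -> rat^o} := \0%R.
  by rewrite (@freeg_linearP _ _ Z N) // => s; rewrite ZE.
rewrite -(Z0 d); apply: (@freeg_linearP _ _ (Phi \o (@boundary R T 1)) Z) => s.
rewrite ZE /= /boundary liftU scale1r linear_sum !big_ord_recl big_ord0 /=.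
rewrite !linearZ_LR !PhiE /= expr0 expr1 sqrrN expr1n !scale1r addr0 scaleN1r addrA.
rewrite -[RHS](period_boundary s); congr (_ + _); congr period; congr singular_face.
exact: val_inj.
Qed.

End Period.

(** * Affine simplices *)

Section ZmodIdentities.
Context {V : zmodType}.
Implicit Types a b c d e f g h : V.

Lemma zmod_subACA a b c d : a - b - (c - d) = a - c - (b - d).
Proof. by rewrite opprD addrACA -opprD. Qed.

Lemma zmod_coboundary a b c d e f :
  a - (f - d) - (b - (e - d)) - (c - (f - e)) = a - b - c.
Proof.
rewrite [_ - _ - (b - _)]zmod_subACA zmod_subACA.
have -> : f - d - (e - d) = f - e by rewrite opprB addrA subrK.
by rewrite subrr subr0.
Qed.

Lemma zmod_cancel a b c d e f :
  a - (b - c) - (d - f - b - (e - f - c)) = a - (d - e).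
Proof.
rewrite [d - f - b - _]zmod_subACA [d - f - _]zmod_subACA subrr subr0.
by rewrite zmod_subACA subrr subr0.
Qed.

Lemma zmod_chain a b f g h : a - (f - h) + (b - (g - f)) = a + b - (g - h).
Proof. by rewrite addrACA -opprD [f - h + _]addrC addrA subrK. Qed.

Lemma zmod_extend a b c f g h :
  a - (f - h) + (b - (g - f)) - (a + b - c) = c - (g - h).
Proof. by rewrite zmod_chain; move: (a + b) (g - h) => x z; rewrite opprB addrC addrA subrK. Qed.

Lemma zmod_restrict a b c f g h :
  c - (g - h) + (a + b - c) - (b - (g - f)) = a - (f - h).
Proof. by rewrite [c - _ + _]addrC addrA subrK -(zmod_chain a b f g h) addrK. Qed.

End ZmodIdentities.

Lemma continuous_pair (X U V : topologicalType) (f : X -> U) (g : X -> V) :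
  continuous f -> continuous g -> continuous (fun x => (f x, g x)).
Proof.
move=> cf cg x P [[A B] [/= Aa Bb] AB].
have : nbhs x (f @^-1` A) by exact: cf.
have : nbhs x (g @^-1` B) by exact: cg.
by apply: filterS2 => y By Ay; exact: AB.
Qed.

Lemma continuous_sum (R : realType) (X : topologicalType) n (f : 'I_n -> X -> R) (x : X) :
  (forall i, {for x, continuous (f i)}) -> {for x, continuous (fun y => \sum_i f i y)}.
Proof.
move=> cf; apply: (@cvg_big R _ +%R 0 xpredT _ X (nbhs x) _ f (fun i => f i x)) => //.
  exact: add_continuous.
by move=> i _; exact: cf.
Qed.

Section AffineSimplices.
Context {R : realType} {T : topologicalType}.
Implicit Types (H : R * R -> T) (P Q S : R * R).

(* Meaningful for continuous [f] only. *)
Definition mksingular n (x0 : simplex R n) (f : simplex R n -> T) : singular R T n :=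
  if pselect (continuous f) is left cf then exist _ f (mem_set cf)
  else exist _ (fun=> f x0) (mem_set (@cst_continuous _ _ (f x0))).

Lemma mksingularE n x0 (f : simplex R n -> T) :
  continuous f -> set_val (mksingular x0 f) = f.
Proof. by move=> cf; rewrite /mksingular; case: pselect. Qed.

Definition affine_point n (p : seq (R * R)) (x : simplex R n) : R * R :=
  (\sum_i set_val x 0 i * (nth (0, 0) p i).1, \sum_i set_val x 0 i * (nth (0, 0) p i).2).

Lemma simplex_coord_continuous n (i : 'I_n.+1) :
  continuous (fun x : simplex R n => set_val x 0 i).
Proof.
move=> x; apply: (@continuous_comp _ _ _ set_val (fun y : 'rV[R]_n.+1 => y 0 i)).
  exact: initial_continuous.
exact: coord_continuous.
Qed.

Lemma affine_point_continuous n p : continuous (@affine_point n p).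
Proof.
have c (g : 'I_n.+1 -> R) : continuous (fun x : simplex R n => \sum_i set_val x 0 i * g i).
  move=> x; apply: (@continuous_sum R (simplex R n) _ (fun i (x : simplex R n) => set_val x 0 i * g i)) => i.
  apply: (@continuousM R (simplex R n) (fun x : simplex R n => set_val x 0 i) (cst (g i))).
    exact: (@simplex_coord_continuous n i x).
  exact: (@cst_continuous _ _ (g i) x).
exact: continuous_pair.
Qed.

Definition segment_pt P Q (t : R) : R * R :=
  ((1 - t) * P.1 + t * Q.1, (1 - t) * P.2 + t * Q.2).

Lemma affine_point1 P Q (x : simplex R 1) :
  affine_point [:: P; Q] x = segment_pt P Q (set_val x 0 ord_max).
Proof.
have [_ /=] := set_valP x; rewrite !big_ord_recl big_ord0 addr0 => x1.
rewrite /affine_point /segment_pt !big_ord_recl !big_ord0 /= !addr0.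
have -> : fintype.lift ord0 ord0 = ord_max :> 'I_2 by exact: val_inj.
move: x1; have -> : fintype.lift ord0 ord0 = ord_max :> 'I_2 by exact: val_inj.
by move=> <-; rewrite addrK.
Qed.

Lemma simplex1_itv (x : simplex R 1) : 0 <= set_val x 0 ord_max <= 1.
Proof.
have [x0 /=] := set_valP x; rewrite !big_ord_recl big_ord0 addr0 => <-.
have -> : fintype.lift ord0 ord0 = ord_max :> 'I_2 by exact: val_inj.
by rewrite x0 /= lerDr x0.
Qed.

(** A homotopy of paths is a map [H] of the plane, and relations between chains come from triangles
    drawn in the plane. *)
Definition affine_singular n H p : singular R T n :=
  mksingular (vertex0 n) (H \o @affine_point n p).

Definition seg H P Q : chain R T 1 := << affine_singular 1 H [:: P; Q] >>.

(** An equality of chains, not only of classes, that depends on the maps along the segments alone: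
    it identifies edges of different planar maps. *)
Lemma eq_seg H H' P Q P' Q' :
  (forall t, 0 <= t <= 1 -> H (segment_pt P Q t) = H' (segment_pt P' Q' t)) ->
  seg H P Q = seg H' P' Q'.
Proof.
move=> E; rewrite /seg /affine_singular; congr (<< mksingular _ _ >>).
by apply/funext => x; rewrite /= !affine_point1 E ?simplex1_itv.
Qed.

Lemma affine_point_face (p : seq (R * R)) (i : 'I_3) q (x : simplex R 1) :
  (forall k : 'I_2, nth (0, 0) p (fintype.lift i k) = nth (0, 0) q k) ->
  affine_point p (face i x) = affine_point q x.
Proof.
move=> E; rewrite /affine_point; congr (_, _); rewrite (bigD1_ord i) //= mxE unlift_none mul0r add0r;
  by apply: eq_bigr => j _; rewrite mxE liftK E.
Qed.

Lemma affine_boundary H P Q S : continuous H ->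
  boundary (<< affine_singular 2 H [:: P; Q; S] >> : chain R T 2)
  = seg H Q S - seg H P S + seg H P Q.
Proof.
move=> cH.
have cHa n p : continuous (H \o @affine_point n p).
  by move=> x; apply: continuous_comp; [exact: affine_point_continuous | exact: cH].
have faceE (i : 'I_3) q :
  (forall k : 'I_2, nth (0, 0) [:: P; Q; S] (fintype.lift i k) = nth (0, 0) q k) ->
  singular_face i (affine_singular 2 H [:: P; Q; S]) = affine_singular 1 H q.
  move=> E; apply: val_inj; rewrite [RHS]mksingularE //= mksingularE //.
  by apply/funext => x; rewrite /= (affine_point_face _ E).
rewrite /boundary liftU scale1r !big_ord_recl big_ord0 /= /bump /=.
rewrite !expr0 expr1 sqrrN expr1n !scale1r addr0 scaleN1r addrA /seg.
rewrite (faceE _ [:: Q; S]); last by case=> [[|[|//]]].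
rewrite (faceE _ [:: P; S]); last by case=> [[|[|//]]].
by rewrite (faceE _ [:: P; Q]); last by case=> [[|[|//]]].
Qed.

Definition null (c : chain R T 1) : Prop := exists d : chain R T 2, boundary d = c.

Lemma nullD c d : null c -> null d -> null (c + d).
Proof. by move=> [a <-] [b <-]; exists (a + b); rewrite linearD. Qed.

Lemma nullN c : null c -> null (- c).
Proof. by move=> [a <-]; exists (- a); rewrite linearN. Qed.

Lemma nullB c d : null c -> null d -> null (c - d).
Proof. by move=> nc nd; exact/nullD/nullN. Qed.

Lemma seg_triangle H P Q S : continuous H ->
  null (seg H Q S - seg H P S + seg H P Q).
Proof. by move=> cH; rewrite -affine_boundary //; eexists. Qed.

(** The square is cut along the diagonal from [(0, 0)] to [(1, 1)], whose two occurrences cancel. *)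
Lemma seg_square H : continuous H ->
  null (seg H (0, 1) (1, 1) + seg H (0, 0) (0, 1) - seg H (1, 0) (1, 1) - seg H (0, 0) (1, 0)).
Proof.
move=> cH; have := nullB (seg_triangle (0, 0) (0, 1) (1, 1) cH)
  (seg_triangle (0, 0) (1, 0) (1, 1) cH).
rewrite [X in X - _]addrAC [X in _ - X]addrAC opprB addrA addrNK opprD addrA.
exact.
Qed.

Lemma seg_const (x : T) P Q : null (seg (fun=> x) P Q).
Proof.
(* The three edges of a degenerate triangle are the same chain, and the signs +, -, + leave one copy
   of it. *)
have := @seg_triangle (fun=> x) P P P (@cst_continuous _ _ x).
by rewrite subrr add0r; congr null; exact: eq_seg.
Qed.

Lemma seg_const0 H P : continuous H -> null (seg H P P).
Proof. by move=> /(seg_triangle P P P); rewrite subrr add0r. Qed.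

Definition path_chain (u : R -> T) a b : chain R T 1 := seg (u \o fst) (a, 0) (b, 0).

Lemma path_chain_add u a b c : continuous u ->
  null (path_chain u a b + path_chain u b c - path_chain u a c).
Proof.
move=> cu; have : continuous (u \o fst : R * R -> T).
  by move=> z; apply: continuous_comp; [exact: cvg_fst | exact: cu].
move=> /(seg_triangle (a, 0) (b, 0) (c, 0)).
by rewrite /path_chain addrC addrA.
Qed.

Lemma path_chain_reparam u a b :
  path_chain u a b = path_chain (fun t => u (a + (b - a) * clamp01 t)) 0 1.
Proof.
apply: eq_seg => t t01 /=; rewrite mulr0 mulr1 add0r clamp01_id //; congr u.
by ring.
Qed.

(** Being an equality of generators, it transfers results on path chains to all singular
    1-simplices. *)
Lemma singular_pathK (s : singular R T 1) :
  << s >> = path_chain (singular_path s) 0 1.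
Proof.
rewrite /path_chain /seg; congr (<< _ >>); apply: val_inj; rewrite [RHS]mksingularE; last first.
  move=> x; apply: (@continuous_comp _ _ _ (@affine_point 1 [:: (0, 0); (1, 0)]) (singular_path s \o fst)).
    exact: affine_point_continuous.
  by apply: continuous_comp; [exact: cvg_fst | exact: singular_path_continuous].
apply: funext => x; rewrite -[RHS]/(singular_path s (affine_point [:: (0, 0); (1, 0)] x).1).
rewrite affine_point1 /= mulr0 mulr1 add0r /singular_path /=.
congr (set_val s _); apply: val_inj; apply/rowP => j; rewrite mxE /= clamp01_id ?simplex1_itv //.
have [_ /=] := set_valP x; rewrite !big_ord_recl big_ord0 addr0.
have -> : fintype.lift ord0 ord0 = ord_max :> 'I_2 by exact: val_inj.
case: j => [[|[|//]]] j2 /= E; last by congr (set_val x 0 _); exact: val_inj.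
by rewrite -E addrK; congr (set_val x 0 _); exact: val_inj.
Qed.

End AffineSimplices.

(** * The first homology of the 3-sphere *)

Section Sphere.
Context {R : realType}.

Lemma dotprodC n (x y : 'rV[R]_n) : dotprod x y = dotprod y x.
Proof. by apply: eq_bigr => i _; rewrite mulrC. Qed.

Lemma dotprodDl n (x y z : 'rV[R]_n) : dotprod (x + y) z = dotprod x z + dotprod y z.
Proof. by rewrite -big_split; apply: eq_bigr => i _; rewrite !mxE mulrDl. Qed.

Lemma dotprodZl n a (x z : 'rV[R]_n) : dotprod (a *: x) z = a * dotprod x z.
Proof. by rewrite /dotprod big_distrr; apply: eq_bigr => i _; rewrite !mxE /= mulrA. Qed.

Lemma dotprodZr n a (x z : 'rV[R]_n) : dotprod x (a *: z) = a * dotprod x z.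
Proof. by rewrite dotprodC dotprodZl dotprodC. Qed.

Lemma dotprod_ge0 n (x : 'rV[R]_n) : 0 <= dotprod x x.
Proof. by apply: sumr_ge0 => i _; rewrite -expr2 sqr_ge0. Qed.

Lemma dotprod_eq0 n (x : 'rV[R]_n) : (dotprod x x == 0) = (x == 0).
Proof.
apply/eqP/eqP => [|->]; last by apply: big1 => i _; rewrite mxE mul0r.
move=> /eqP; rewrite psumr_eq0 => [/allP h|i _]; last by rewrite -expr2 sqr_ge0.
apply/rowP => i; have := h i (mem_index_enum i).
by rewrite /= -expr2 sqrf_eq0 mxE => /eqP.
Qed.

Local Notation sphere := (set_type (@unit_sphere R 3)).

Lemma sphereE (x : sphere) : dotprod (set_val x) (set_val x) = 1.
Proof. exact: (set_valP x). Qed.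

Definition basis_vector (i : 'I_4) : 'rV[R]_4 := delta_mx 0 i.

Fact basis_vector_unit i : unit_sphere (basis_vector i).
Proof.
rewrite /unit_sphere /= /dotprod (bigD1 i) //= big1 => [|j /negbTE ji].
  by rewrite !mxE !eqxx mulr1 addr0.
by rewrite !mxE ji andbF mul0r.
Qed.

Definition basis_point i : sphere := exist _ (basis_vector i) (mem_set (basis_vector_unit i)).

Definition normalize (v : 'rV[R]_4) : 'rV[R]_4 :=
  if v == 0 then basis_vector ord0 else (Num.sqrt (dotprod v v))^-1 *: v.

Fact normalize_unit v : unit_sphere (normalize v).
Proof.
rewrite /normalize; case: eqP => [_|/eqP v0]; first exact: basis_vector_unit.
rewrite /unit_sphere /= dotprodZl dotprodZr mulrA -invfM -expr2 sqr_sqrtr ?dotprod_ge0 //.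
by rewrite mulVf // dotprod_eq0.
Qed.

Definition to_sphere v : sphere := exist _ (normalize v) (mem_set (normalize_unit v)).

Lemma to_sphereE (v : 'rV[R]_4) : v != 0 ->
  set_val (to_sphere v) = (Num.sqrt (dotprod v v))^-1 *: v.
Proof. by move=> v0; rewrite -[LHS]/(normalize v) /normalize ifN. Qed.

Lemma to_sphereK (x : sphere) : to_sphere (set_val x) = x.
Proof.
apply: val_inj; rewrite /= /normalize sphereE sqrtr1 invr1 scale1r.
case: eqP => // x0; have := sphereE x; rewrite x0 /dotprod big1 => [/esym/eqP|i _].
  by rewrite oner_eq0.
by rewrite mxE mul0r.
Qed.

Lemma to_sphere_continuous (X : topologicalType) (f : X -> 'rV[R]_4) :
  (forall x, f x != 0) -> continuous f -> continuous (to_sphere \o f).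
Proof.
move=> f0 cf; apply: continuous_comp_initial; apply: continuous_rV => j.
have cfi i : continuous (fun x => f x 0 i).
  move=> x; apply: (@continuous_comp _ _ _ f (fun y : 'rV[R]_4 => y 0 i)); first exact: cf.
  exact: coord_continuous.
have cd : continuous (fun x => dotprod (f x) (f x)).
  move=> x; apply: (@continuous_sum R X _ (fun i x => f x 0 i * f x 0 i)) => i.
  by apply: (@continuousM R X (fun x => f x 0 i) (fun x => f x 0 i)); exact: cfi.
have -> : (fun x => (set_val \o (to_sphere \o f)) x 0 j) =
    (fun x => (Num.sqrt (dotprod (f x) (f x)))^-1) \* (fun x => f x 0 j).
  by apply/funext => x; rewrite ![in LHS]/= to_sphereE // mxE.
move=> x; apply: (@continuousM R X (fun x => (Num.sqrt (dotprod (f x) (f x)))^-1) (fun x => f x 0 j)); last exact: cfi.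
apply: (@continuousV R X (fun x => Num.sqrt (dotprod (f x) (f x)))).
  by rewrite sqrtr_eq0 -ltNge lt_neqAle dotprod_ge0 eq_sym dotprod_eq0 f0.
apply: (@continuous_comp _ _ _ (fun x => dotprod (f x) (f x)) (@Num.sqrt R)); first exact: cd.
exact: sqrt_continuous.
Qed.

(** If the combination vanished, comparing norms would give [t = 1/2], and then [x] would be the
    antipode of [r]. *)
Lemma cone_neq0 (r x : sphere) t : set_val x != - set_val r -> 0 <= t <= 1 ->
  (1 - t) *: set_val r + t *: set_val x != 0.
Proof.
move=> xr /andP[t0 t1]; apply/eqP => E.
have E1 : (1 - t) *: set_val r = - t *: set_val x.
  by apply/eqP; rewrite -subr_eq0 scaleNr opprK E.
have : dotprod ((1 - t) *: set_val r) ((1 - t) *: set_val r) =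
    dotprod ((- t) *: set_val x) ((- t) *: set_val x) by rewrite E1.
rewrite !dotprodZl !dotprodZr !sphereE !mulr1 => E2.
have t2 : t = 2^-1 by nra.
have h : t != 0 by rewrite t2 invr_eq0 pnatr_eq0.
move/eqP: xr; apply; apply: (scalerI h); rewrite scalerN.
have -> : t *: set_val r = (1 - t) *: set_val r by congr (_ *: _); rewrite t2; lra.
by rewrite E1 scaleNr opprK.
Qed.

Definition cone (u : R -> sphere) (r : sphere) (z : R * R) : sphere :=
  to_sphere ((1 - clamp01 z.2) *: set_val r + clamp01 z.2 *: set_val (u z.1)).

Lemma cone_continuous (u : R -> sphere) (r : sphere) : continuous u ->
  (forall t, set_val (u t) != - set_val r) -> continuous (cone u r).
Proof.
move=> cu ur; apply: to_sphere_continuous => [z|].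
  by rewrite cone_neq0 ?clamp01_itv.
apply: continuous_rV => j z.
have c2 : {for z, continuous (fun z : R * R => clamp01 z.2)}.
  by apply: continuous_comp; [exact: cvg_snd | exact: clamp01_continuous].
have cuj : {for z, continuous (fun z : R * R => set_val (u z.1) 0 j)}.
  apply: (@continuous_comp _ _ _ fst (fun t => set_val (u t) 0 j)); first exact: cvg_fst.
  apply: (@continuous_comp _ _ _ u (fun x : sphere => set_val x 0 j)); first exact: cu.
  apply: (@continuous_comp _ _ _ set_val (fun x : 'rV[R]_4 => x 0 j)).
    exact: initial_continuous.
  exact: coord_continuous.
rewrite [X in continuous_at _ X](_ : _ = (fun z : R * R =>
  (1 - clamp01 z.2) * set_val r 0 j + clamp01 z.2 * set_val (u z.1) 0 j)); last first.
  by apply/funext => w; rewrite !mxE.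
apply: cvgD; last exact: cvgM.
by apply: cvgM; [apply: cvgB => //; exact: cvg_cst | exact: cvg_cst].
Qed.

Definition geodesic (r x : sphere) (t : R) : sphere :=
  to_sphere ((1 - clamp01 t) *: set_val r + clamp01 t *: set_val x).

Definition geodesic_chain r x := path_chain (geodesic r x) 0 1.

Lemma geodesic_continuous (r x : sphere) : set_val x != - set_val r -> continuous (geodesic r x).
Proof.
move=> xr t; apply: (@continuous_comp _ _ _ (fun t => (0 : R, t)) (cone (fun=> x) r)).
  exact: pair_continuousr.
apply: (@cone_continuous (fun=> x) r); first exact: cst_continuous.
by move=> _; exact: xr.
Qed.

Lemma geodesic0 (r x : sphere) : geodesic r x (0 : R) = r :> sphere.
Proof.
rewrite /geodesic clamp01_id ?lexx ?ler01 //.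
by rewrite subr0 scale1r scale0r addr0 to_sphereK.
Qed.

Lemma geodesic1 (r x : sphere) : geodesic r x 1 = x.
Proof.
rewrite /geodesic clamp01_id ?lexx ?ler01 //.
by rewrite subrr scale1r scale0r add0r to_sphereK.
Qed.

(** The cone from [r] over [u] is a square whose bottom edge is constant, whose top edge is [u] and
    whose vertical edges are the geodesics from [r] to the end points of [u]. *)
Lemma cone_null (u : R -> sphere) (r : sphere) : continuous u -> (forall t, set_val (u t) != - set_val r) ->
  null (path_chain u 0 1 - (geodesic_chain r (u 1) - geodesic_chain r (u 0))).
Proof.
move=> cu ur; have := nullD (seg_square (cone_continuous cu ur)) (seg_const r (0, 0) (1, 0)).
have c0 : clamp01 0 = 0 :> R by rewrite clamp01_id // lexx ler01.
have c1 : clamp01 1 = 1 :> R by rewrite clamp01_id // lexx ler01.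
have -> : seg (cone u r) (0, 1) (1, 1) = path_chain u 0 1.
  apply: eq_seg => t _; rewrite /cone /= !mulr1 !mulr0 subrK add0r c1 subrr scale0r add0r scale1r.
  exact: to_sphereK.
have -> : seg (cone u r) (0, 0) (1, 0) = seg (fun=> r) (0, 0) (1, 0).
  apply: eq_seg => t _; rewrite /cone /= !mulr0 addr0 c0 subr0 scale0r addr0 scale1r.
  exact: to_sphereK.
have -> : seg (cone u r) (0, 0) (0, 1) = geodesic_chain r (u 0).
  by apply: eq_seg => t _; rewrite /cone /geodesic /= !mulr0 !mulr1 !add0r.
have -> : seg (cone u r) (1, 0) (1, 1) = geodesic_chain r (u 1).
  by apply: eq_seg => t _; rewrite /cone /geodesic /= !mulr0 !mulr1 !add0r subrK.
by rewrite subrK opprB addrA.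
Qed.

(** Three linear equations in four unknowns have a non-zero solution, which is then normalized. *)
Lemma orthogonal_point (p q x : sphere) : exists r : sphere,
  [/\ dotprod (set_val r) (set_val p) = 0, dotprod (set_val r) (set_val q) = 0 &
      dotprod (set_val r) (set_val x) = 0].
Proof.
pose A : 'M[R]_(4, 3) := \matrix_(i, j) nth 0 [:: set_val p 0 i; set_val q 0 i; set_val x 0 i] j.
have : kermx A != 0.
  by rewrite -mxrank_eq0 mxrank_ker -lt0n subn_gt0 (leq_ltn_trans (rank_leq_col A)).
move=> /rowV0Pn[v /sub_kermxP vA v0].
exists (to_sphere v).
suff h (w : 'rV[R]_4) (j : 'I_3) : (forall i, A i j = w 0 i) -> dotprod (set_val (to_sphere v)) w = 0.
  by split; [apply: (h _ ord0)|apply: (h _ (inord 1 : 'I_3))|apply: (h _ ord_max)] => i; rewrite mxE //= inordK.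
move=> E; rewrite to_sphereE // dotprodZl.
have -> : dotprod v w = (v *m A) 0 j by rewrite mxE; apply: eq_bigr => i _; rewrite E.
by rewrite vA mxE mulr0.
Qed.

(** The geodesic stays in the hyperplane orthogonal to [r], which does not contain the antipode of
    [r]. Hence [cone_null] applies to it with apex [r]. *)
Lemma orthogonal_geodesic (r p x : sphere) t : set_val x != - set_val p ->
  dotprod (set_val r) (set_val p) = 0 -> dotprod (set_val r) (set_val x) = 0 ->
  set_val (geodesic p x t) != - set_val r.
Proof.
move=> xp rp rx; apply/eqP => E.
have : dotprod (set_val (geodesic p x t)) (set_val r) = 0.
  rewrite to_sphereE ?cone_neq0 ?clamp01_itv //.
  rewrite dotprodC in rp; rewrite dotprodC in rx.
  rewrite dotprodZl; move: (_^-1) => q.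
  by rewrite dotprodDl !dotprodZl rp rx !mulr0 addr0 mulr0.
rewrite E -scaleN1r dotprodZl sphereE mulr1 => /eqP.
by rewrite oppr_eq0 oner_eq0.
Qed.

(* Every side is homologous to a difference of geodesics issued from a point
   orthogonal to the three vertices. *)
Lemma geodesic_triangle (p q x : sphere) : set_val q != - set_val p ->
  set_val x != - set_val p -> set_val x != - set_val q ->
  null (geodesic_chain p x - geodesic_chain p q - geodesic_chain q x).
Proof.
move=> qp xp xq; have [r [rp rq rx]] := orthogonal_point p q x.
have g (a b : sphere) : set_val b != - set_val a -> dotprod (set_val r) (set_val a) = 0 ->
    dotprod (set_val r) (set_val b) = 0 ->
    null (geodesic_chain a b - (geodesic_chain r b - geodesic_chain r a)).
  move=> ba ra rb; have := @cone_null (geodesic a b) r (geodesic_continuous ba) _.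
  rewrite geodesic0 geodesic1; apply => t; exact: orthogonal_geodesic.
have := nullB (nullB (g _ _ xp rp rx) (g _ _ qp rp rq)) (g _ _ xq rq rx).
move: (geodesic_chain p x) (geodesic_chain p q) (geodesic_chain q x) => a b c.
move: (geodesic_chain r p) (geodesic_chain r q) (geodesic_chain r x) => d e f.
congr null; exact: zmod_coboundary.
Qed.

Definition base_point : sphere := basis_point ord0.
Definition aux_point : sphere := basis_point ord_max.

Lemma aux_neq_base : set_val aux_point != set_val base_point.
Proof.
apply/eqP => /rowP/(_ ord0); rewrite /= !mxE /= => /eqP.
by rewrite eq_sym oner_eq0.
Qed.

Lemma aux_base : set_val aux_point != - set_val base_point.
Proof.
apply/eqP => /rowP/(_ ord0); rewrite /= !mxE /= => /eqP.
by rewrite eq_sym oppr_eq0 oner_eq0.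
Qed.

(* The geodesic from [base_point] to its antipode is not unique: pass through
   [aux_point]. *)
Definition standard_chain (x : sphere) : chain R sphere 1 :=
  if set_val x == - set_val base_point
  then geodesic_chain base_point aux_point + geodesic_chain aux_point x
  else geodesic_chain base_point x.

Lemma standard_chain_aux (x : sphere) : set_val x != - set_val aux_point ->
  null (standard_chain x - geodesic_chain base_point aux_point - geodesic_chain aux_point x).
Proof.
move=> xq; rewrite /standard_chain; case: ifPn => [_|xp]; last first.
  by apply: geodesic_triangle => //; exact: aux_base.
by rewrite addrAC addrK addrN; exists 0; rewrite linear0.
Qed.

(** In the second case the path is coned off from [aux_point]; passing from geodesics issued there
    to standard chains adds the same chain from [base_point] to [aux_point] at both ends, and it
    cancels. *)
Lemma standard_chain_local (u : R -> sphere) : continuous u ->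
  (forall t, set_val (u t) != - set_val base_point) \/
  (forall t, set_val (u t) != - set_val aux_point) ->
  null (path_chain u 0 1 - (standard_chain (u 1) - standard_chain (u 0))).
Proof.
move=> cu [up|uq].
  by rewrite /standard_chain !ifN //; exact: cone_null.
have := nullB (cone_null cu uq) (nullB (standard_chain_aux (uq 1)) (standard_chain_aux (uq 0))).
move: (path_chain u 0 1) (geodesic_chain _ (u 1)) (geodesic_chain _ (u 0)) => a b c.
move: (standard_chain (u 1)) (standard_chain (u 0)) (geodesic_chain _ _) => d e f.
congr null; exact: zmod_cancel.
Qed.

(** The antipodes of [base_point] and [aux_point] are distinct, so around each time the path avoids
    one of them and the local statement applies. The pieces are concatenated by connectedness of the
    interval. *)
Lemma standard_chain_path (u : R -> sphere) : continuous u ->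
  null (path_chain u 0 1 - (standard_chain (u 1) - standard_chain (u 0))).
Proof.
move=> cu.
pose P t := null (path_chain u 0 t - (standard_chain (u t) - standard_chain (u 0))).
apply: (@segment_ind R P 0 1) => //; last first.
  rewrite /P subrr subr0; apply: seg_const0 => z.
  by apply: (@continuous_comp _ _ _ fst u); [exact: cvg_fst | exact: cu].
move=> x _ _.
have open_ne (v : 'rV[R]_4) : set_val (u x) != v ->
    \forall y \near x, set_val (u y) != v.
  move=> xv; have cs : {for x, continuous (set_val \o u)}.
    by apply: continuous_comp; [exact: cu | exact: initial_continuous].
  apply: (cs [set w | w != v]); apply: open_nbhs_nbhs; split=> //.
  have -> : [set w | w != v] = ~` [set v].
    by apply/seteqP; split=> w /= /eqP.
  apply: closed_openC; apply: accessible_closed_set1.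
  exact/hausdorff_accessible/norm_hausdorff.
have [e e0 loc] : exists2 e : R, 0 < e &
    (forall t, ball x e t -> set_val (u t) != - set_val base_point) \/
    (forall t, ball x e t -> set_val (u t) != - set_val aux_point).
  have [E|/open_ne/nbhs_ballP[e e0 h]] := eqVneq (set_val (u x)) (- set_val base_point).
    have : set_val (u x) != - set_val aux_point.
      by rewrite E eqr_opp eq_sym; exact: aux_neq_base.
    by move=> /open_ne/nbhs_ballP[e e0 h]; exists e => //; right => t /h.
  by exists e => //; left => t /h.
have step y : ball x e y -> null (path_chain u x y - (standard_chain (u y) - standard_chain (u x))).
  move=> xy; rewrite path_chain_reparam.
  have bt t : ball x e (x + (y - x) * clamp01 t).
    have /andP[t0 t1] := clamp01_itv t.
    apply: le_lt_trans xy; rewrite opprD addrA subrr add0r normrN normrM distrC.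
    by rewrite ler_piMr ?normr_ge0 // ger0_norm.
  have := @standard_chain_local (fun t => u (x + (y - x) * clamp01 t)) _ _.
  have -> : x + (y - x) * clamp01 1 = y.
    by rewrite clamp01_id ?lexx ?ler01 // mulr1 addrC subrK.
  have -> : x + (y - x) * clamp01 0 = x.
    by rewrite clamp01_id ?lexx ?ler01 // mulr0 addr0.
  apply.
  - move=> t; apply: (@continuous_comp _ _ _ (fun t => x + (y - x) * clamp01 t) u); last exact: cu.
    apply: cvgD; first exact: cvg_cst.
    by apply: cvgM; [exact: cvg_cst | exact: clamp01_continuous].
  - by case: loc => loc; [left|right] => t; exact: loc.
near=> y => _ _.
have /step h1 : ball x e y by near: y; exact: nbhsx_ballx.
have h2 := path_chain_add 0 x y cu.
move: h1 h2; rewrite /P.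
move: (path_chain u 0 x) (path_chain u x y) (path_chain u 0 y) => a b c.
move: (standard_chain (u x)) (standard_chain (u y)) (standard_chain (u 0)) => f g h.
move=> h1 h2.
split=> h3.
  by have := nullB (nullD h3 h1) h2; congr null; exact: zmod_extend.
by have := nullB (nullD h3 h2) h1; congr null; exact: zmod_restrict.
Unshelve. all: by end_near. Qed.

Definition vertex_chain (s : singular R sphere 0) : chain R sphere 1 :=
  standard_chain (set_val s (vertex0 0)).

(** A chain homotopy: on generators, hence on all chains, the boundary of [D] is the identity minus
    [G] composed with the boundary. On a cycle the last term vanishes. *)
Lemma sphere_cycle1 (c : chain R sphere 1) : boundary c = 0 -> null c.
Proof.
move=> c0.
have nul (s : singular R sphere 1) : exists d : chain R sphere 2,
    boundary d = << s >> - (standard_chain (singular_path s 1) - standard_chain (singular_path s 0)).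
  by rewrite {1}singular_pathK; apply: standard_chain_path; exact: singular_path_continuous.
have /choice[d dE] := nul.
have [D DE] := freeg_linear_ext d.
have [G GE] := freeg_linear_ext vertex_chain.
exists (D c).
pose L : {linear chain R sphere 1 -> chain R sphere 1} := idfun \- (G \o @boundary R sphere 0).
have : (@boundary R sphere 1 \o D) =1 L.
  apply: freeg_linearP => s; rewrite /= DE dE; congr (_ - _).
  rewrite /boundary liftU scale1r !big_ord_recl big_ord0 /= expr0 expr1 scale1r scaleN1r addr0.
  have -> : singular_path s 1 = set_val s (face ord0 (vertex0 0)) by rewrite face0_vertex0.
  have -> : singular_path s 0 = set_val s (face (fintype.lift ord0 ord0) (vertex0 0)) by rewrite face1_vertex0.
  by rewrite raddfB /= !GE.
by move=> /(_ c) /=; rewrite c0 linear0 subr0.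
Qed.

End Sphere.

Lemma rational_homology_sphere_null (R : realType) (M : manifold3 R) (c : chain R M 1) :
  rational_homology_sphere M -> boundary c = 0 -> null c.
Proof.
move=> [_ _ _ /(_ 1%N)[f [g gK fK]]] c0.
have sphere0 (z : homology R (set_type (@unit_sphere R 3)) 1) : z = homology_class 0.
  elim/homology_ind: z => z; apply/homology_classP; rewrite subr0.
  have /sphere_cycle1[d dz] : boundary (cycle_chain z) = 0.
    by have := valP z; rewrite unfold_in => /eqP.
  by apply/asboolP; exists d.
have cc : c \in @is_cycle R M 1 by rewrite unfold_in /= c0.
have : homology_class (Cycle cc) = homology_class 0.
  by rewrite -[LHS]gK -[RHS]gK (sphere0 (f _)) [in RHS](sphere0 (f _)).
move=> /homology_classP; rewrite subr0 => /asboolP[d dc].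
by exists d.
Qed.

Lemma loop_singular_continuous (R : realType) (T : topologicalType) (g : R -> T) :
  continuous g -> continuous (fun x : simplex R 1 => g (set_val x 0 ord_max)).
Proof.
move=> cg x; apply: (@continuous_comp _ _ _ (fun x : simplex R 1 => set_val x 0 ord_max) g).
  exact: simplex_coord_continuous.
exact: cg.
Qed.

Lemma loop_boundary (R : realType) (T : topologicalType) (s : singular R T 1) :
  singular_path s 0 = singular_path s 1 -> boundary (<< s >> : chain R T 1) = 0.
Proof.
move=> E; rewrite /boundary liftU scale1r !big_ord_recl big_ord0 /=.
rewrite expr0 expr1 scale1r scaleN1r addr0.
suff -> : singular_face ord0 s = singular_face (fintype.lift ord0 ord0) s by rewrite subrr.
have v (x : simplex R 0) : x = vertex0 0.
  apply: val_inj; apply/rowP => j; have [_ /=] := set_valP x.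
  by rewrite big_ord_recl big_ord0 addr0 !ord1 mxE => ->.
apply: val_inj; apply: funext => x; rewrite (v x).
by rewrite /= face0_vertex0 face1_vertex0; exact: esym.
Qed.

(** * Directions transverse to the leaves *)

Section Calculus.
Context {R : realType}.

Lemma det_continuous n : continuous (fun B : 'M[R]_n => \det B).
Proof.
move=> B; apply: (@cvg_big R _ +%R 0 xpredT add_continuous _ (nbhs B) _
  (fun (s : 'S_n) (C : 'M[R]_n) => (-1) ^+ s * \prod_i C i (s i))
  (fun s => (-1) ^+ s * \prod_i B i (s i))) => s _.
apply: cvgM; first exact: cvg_cst.
apply: (@cvg_big R _ *%R 1 xpredT (@mul_continuous R) _ (nbhs B) _
  (fun i (C : 'M[R]_n) => C i (s i)) (fun i => B i (s i))) => i _.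
exact: coord_continuous.
Qed.

Lemma det_neq0_near n (B : 'M[R]_n) : \det B != 0 ->
  exists2 d : R, 0 < d & forall C : 'M[R]_n,
    (forall i j, ball (B i j) d (C i j)) -> \det C != 0.
Proof.
move=> B0.
have : nbhs (\det B) [set x | x != 0].
  apply: open_nbhs_nbhs; split=> //; exact: open_neq.
move=> /(@det_continuous n B) /nbhs_ballP[d /= d0 dB]; exists d => // C BC.
by apply: dB; split.
Qed.

(** The theorem is applied to the single coordinate [j], so the intermediate point depends on [j].
    Only one partial derivative is required, because the inverse of a foliated chart is assumed
    differentiable only along the plaques. *)
Lemma partial_MVT n (Phi : 'rV[R]_n -> 'rV[R]_n) (y0 y : 'rV[R]_n) (i j : 'I_n) (r d : R) :
  (forall z, ball y0 r z -> derivable Phi z (delta_mx 0 i)) ->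
  ball y0 r y -> ball y0 r (y + d *: delta_mx 0 i) ->
  exists2 z, ball y0 r z &
    (Phi (y + d *: delta_mx 0 i) - Phi y) 0 j = d * ('D_(delta_mx 0 i) Phi z) 0 j.
Proof.
move=> dPhi by_ byd.
pose l (t : R) := y + t *: delta_mx 0 i : 'rV[R]_n.
pose g (t : R) := Phi (l t) 0 j.
have bl t : Num.min 0 d <= t <= Num.max 0 d -> ball y0 r (l t).
  rewrite ge_min le_max => tm; case: by_ byd => [r0 yr] [_ ydr]; split=> // a k.
  have := yr a k; have := ydr a k; rewrite /l !mxE (ord1 a) /ball /= !ltr_norml.
  case: eqP => [_|_]; rewrite ?mulr1 ?mulr0 ?addr0 // => /andP[h1 h2] /andP[h3 h4].
  by case/andP: tm => /orP[] ? /orP[] ?; apply/andP; split; lra.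
have dg (t : R) : Num.min 0 d <= t <= Num.max 0 d ->
    is_derive t 1 g (('D_(delta_mx 0 i) Phi (l t)) 0 j).
  move=> /bl /dPhi dt.
  have dj : derivable (fun x => Phi x 0 j) (l t) (delta_mx 0 i) by move/derivable_mxP : dt.
  rewrite (derive_mx dt) mxE.
  have E : (fun h : R => h^-1 *: ((g \o shift t) (h *: 1) - g t)) =
    (fun h => h^-1 *: (((fun x => Phi x 0 j) \o shift (l t)) (h *: delta_mx 0 i) - Phi (l t) 0 j)).
    apply/funext => h; rewrite /g /l /=; congr (_ *: (Phi _ 0 j - _)).
    by rewrite [h *: 1]mulr1 scalerDl addrCA.
  by split; rewrite /derivable /derive E.
have mvt (a b : R) : a <= b -> (forall t, a <= t <= b -> Num.min 0 d <= t <= Num.max 0 d) ->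
    exists2 z, ball y0 r z & g b - g a = ('D_(delta_mx 0 i) Phi z) 0 j * (b - a).
  move=> ab h.
  have [t|t|t tab E] := @MVT_segment R g (fun t => ('D_(delta_mx 0 i) Phi (l t)) 0 j) a b ab.
  - by rewrite in_itv /= => /andP[? ?]; apply: dg; apply: h; rewrite !ltW.
  - apply: derivable_within_continuous => x; rewrite in_itv /= => xab.
    by have [] := dg x (h x xab).
  exists (l t); last exact: E.
  by apply: bl; apply: h; move: tab; rewrite in_itv.
have l0 : l 0 = y by rewrite /l scale0r addr0.
have [d0|d0] := leP 0 d.
  have [|z bz E] := mvt 0 d d0; first by move=> t; rewrite min_l // max_r.
  exists z => //; rewrite subr0 /g l0 mulrC in E.
  by rewrite !mxE -E.
have [|z bz E] := mvt d 0 (ltW d0); first by move=> t; rewrite min_r ?max_l // ltW.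
exists z => //; rewrite sub0r mulrN /g l0 mulrC in E.
by rewrite !mxE -[RHS]opprK -E opprB.
Qed.

Lemma derivable_quotient n (f : R -> 'rV[R]_n) (t0 e : R) : derivable f t0 1 -> 0 < e ->
  \forall t \near t0, t != t0 -> ball ('D_1 f t0) e ((t - t0)^-1 *: (f t - f t0)).
Proof.
move=> df e0.
have : \forall h \near 0^', ball ('D_1 f t0) e (h^-1 *: ((f \o shift t0) (h *: 1) - f t0)).
  by move: df; rewrite /derivable => /(_ (ball ('D_1 f t0) e)); apply; exact: nbhsx_ballx.
move=> /nbhs_ballP[d /= d0 hd]; apply/nbhs_ballP; exists d => //= t td tt0.
have := hd (t - t0) _ _; rewrite /= [(t - t0)%:A]mulr1 subrK; apply.
  by rewrite /ball /= sub0r opprB; move: td; rewrite /ball /=.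
by rewrite subr_eq0.
Qed.

Lemma sgz_near (X : topologicalType) (f : X -> R) (x : X) :
  {for x, continuous f} -> f x != 0 -> \forall y \near x, sgz (f y) = sgz (f x).
Proof.
move=> cf; rewrite neq_lt => /orP[f0|f0].
  have : \forall y \near x, f y < 0 by exact: (cf [set z | z < 0] (lt_nbhsl f0)).
  by apply: filterS => y fy; rewrite !ltr0_sgz.
have : \forall y \near x, 0 < f y by exact: (cf [set z | 0 < z] (lt_nbhsr f0)).
by apply: filterS => y fy; rewrite !gtr0_sgz.
Qed.

End Calculus.

Section Coordinates3.
Context {R : realType}.

Lemma ord3P (P : 'I_3 -> Prop) : P e0 -> P e1 -> P ord_max -> forall j, P j.
Proof.
move=> P0 P1 P2 j.
have [->//|j0] := eqVneq j e0; have [->//|j1] := eqVneq j e1.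
suff -> : j = ord_max by [].
move: j0 j1; rewrite -!val_eqE /= !inordK // => j0 j1; apply: val_inj => /=.
by case: j j0 j1 => [[|[|[|]]]].
Qed.

Definition rows3 (u0 u1 u2 : 'I_3 -> R) : 'M[R]_3 :=
  \matrix_(i, j) nth 0 [:: u0 j; u1 j; u2 j] i.

Lemma rows3E u0 u1 u2 j :
  [/\ rows3 u0 u1 u2 e0 j = u0 j, rows3 u0 u1 u2 e1 j = u1 j & rows3 u0 u1 u2 ord_max j = u2 j].
Proof. by rewrite !mxE /= !inordK. Qed.

Lemma mul_rows3 (z : 'rV[R]_3) u0 u1 u2 j :
  (z *m rows3 u0 u1 u2) 0 j = z 0 e0 * u0 j + z 0 e1 * u1 j + z 0 ord_max * u2 j.
Proof.
rewrite !mxE !big_ord_recl big_ord0 !mxE /= addr0 addrA.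
by congr (z 0 _ * _ + z 0 _ * _ + z 0 _ * _); apply: val_inj; rewrite /= ?inordK.
Qed.

Lemma shift_e0 (y y' : 'rV[R]_3) : let y'' := y + (y' 0 e0 - y 0 e0) *: delta_mx 0 e0 in
  [/\ y'' 0 e0 = y' 0 e0, y'' 0 e1 = y 0 e1 & y'' 0 ord_max = y 0 ord_max].
Proof.
rewrite /= !mxE -!val_eqE /= !inordK //=.
by rewrite mulr1 !mulr0 !addr0 addrC subrK.
Qed.

(** Two points at the same height are joined by a step along [e0] followed by one along [e1], so
    that each step involves one partial derivative. *)
Lemma shift_e0_e1 (y y' : 'rV[R]_3) : y' 0 ord_max = y 0 ord_max ->
  y' = y + (y' 0 e0 - y 0 e0) *: delta_mx 0 e0 + (y' 0 e1 - y 0 e1) *: delta_mx 0 e1.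
Proof.
move=> E; have /= [E0 E1 E2] := shift_e0 y y'; move: (y + _) E0 E1 E2 => z E0 E1 E2.
apply/rowP; apply: ord3P; rewrite [RHS]mxE [X in _ + X]mxE [delta_mx _ _ _ _]mxE
    -!val_eqE /= !inordK //= ?mulr0 ?mulr1 ?addr0 ?E0 ?E1 ?E2 //.
by rewrite addrC subrK.
Qed.

End Coordinates3.

Section Upward.
Context {R : realType} {M : manifold3 R} (F : foliation M).

(* Every vector close to [v] at a point close to [p] crosses the plaques of [b]
   in the direction given by the sign [s]; coordinates are taken in [c]. *)
Definition upward (b c : chart R M) (p : M) (v : 'rV[R]_3) (s : int) : Prop :=
  exists2 e : R, 0 < e & forall (x w : 'rV[R]_3) (t : R),
    ball (cmap c p) e x -> ball v e w -> 0 < t < e ->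
    sgz (height b (cinv c (x + t *: w)) - height b (cinv c x)) = s.

Lemma chart_near (c : chart R M) (p : M) (A : set M) : is_chart c -> cdom c p ->
  nbhs p A -> \forall x \near cmap c p, ccod c x /\ A (cinv c x).
Proof.
move=> [[_ oc] c1 c2 _ c4] cp Ap; have [cc ci] := c1 p cp.
near=> x; split; near: x; first exact: open_nbhs_nbhs.
by apply: (c4 _ cc A); rewrite ci.
Unshelve. all: by end_near. Qed.

Lemma chart_dom_near (c : chart R M) (p : M) : is_chart c -> cdom c p -> nbhs p (cdom c).
Proof. by move=> [[oc _] _ _ _ _] cp; exact: open_nbhs_nbhs. Qed.

(** Origin of the constant: the offset of [x] costs less than [e], and since [w] has norm at most
    [|v| + 1] the displacement costs at most [e * (|v| + 1)]. *)
Lemma step_ball (x0 v x w : 'rV[R]_3) (r e t : R) : 0 < e -> e <= 1 ->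
  e * (`|v| + 2) <= r -> ball x0 e x -> ball v e w -> 0 <= t <= e ->
  ball x0 r (x + t *: w).
Proof.
move=> e0 e1 er; rewrite -!ball_normE /= => bx bw /andP[t0 te].
have -> : x0 - (x + t *: w) = (x0 - x) + t *: ((v - w) - v).
  by rewrite [v - w]addrC addrK scalerN opprD addrA.
apply: le_lt_trans (ler_normD _ _) _.
have : `|t *: (v - w - v)| <= e * (1 + `|v|).
  rewrite normrZ ger0_norm //; apply: ler_pM => //.
  by apply: le_trans (ler_normB _ _) _; rewrite lerD2r (le_trans (ltW bw)).
nra.
Qed.

(* If [x] and [x + t w] lie on the same plaque, the mean value theorem writes
   each coordinate of [t w] as a combination of leaf directions taken at nearby
   points; the determinant of these almost constant rows cannot vanish. *)
Lemma leafwise_noncrossing (b c : chart R M) (p : M) (v : 'rV[R]_3) :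
  fol_atlas F b -> atlas c -> cdom b p -> cdom c p -> ~ leaf_tangent_plane F p c v ->
  exists2 e : R, 0 < e & forall (x w : 'rV[R]_3) (t : R),
    ball (cmap c p) e x -> ball v e w -> 0 < t < e ->
    height b (cinv c (x + t *: w)) <> height b (cinv c x).
Proof.
move=> Fb Ac bp cp vT.
have [cb codb] := fol_chart Fb; have cc := atlas_chart Ac.
have [[ob ocb] b1 b2 b3 b4] := cb.
have [[oc occ] c1 c2 c3 c4] := cc.
pose Phi := transition b c; pose y0 := cmap b p.
have [A0 A0E] : exists A, leaf_direction b c e0 = A by eexists.
have [A1 A1E] : exists A, leaf_direction b c e1 = A by eexists.
have [cy0 iy0] := b1 p bp.
have dom0 : transition_dom b c y0 by split=> //=; rewrite iy0.
have [reg ind] := fol_C1 Fb Ac dom0.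
have [_ cA0] := reg e0 (or_introl erefl); have [_ cA1] := reg e1 (or_intror erefl).
rewrite A0E in cA0; rewrite A1E in cA1; rewrite A0E A1E in ind.
(* Each column [j] has its own sample points [xi j] and [xi' j], since the mean value theorem gives
   a different point for each coordinate. *)
pose B (w : 'rV[R]_3) (xi xi' : 'I_3 -> 'rV[R]_3) : 'M[R]_3 :=
  rows3 (fun j => w 0 j) (fun j => A0 (xi j) 0 j) (fun j => A1 (xi' j) 0 j).
have B0 : \det (B v (fun=> y0) (fun=> y0)) != 0.
  apply/det0P => -[z z0 zB]; move/eqP: z0; apply.
  have E : z 0 e0 *: v + z 0 e1 *: A0 y0 + z 0 ord_max *: A1 y0 = 0.
    apply/rowP => j; have /rowP/(_ j) := zB; rewrite mul_rows3 [RHS]mxE => E.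
    by rewrite [RHS]mxE -E; move: (A0 y0) (A1 y0) => a0 a1; rewrite !mxE.
  have z00 : z 0 e0 = 0.
    apply: contrapT => /eqP n0; apply: vT; exists b; split=> //.
    exists (- (z 0 e0)^-1 * z 0 e1), (- (z 0 e0)^-1 * z 0 ord_max).
    rewrite A0E A1E -/y0 -!scalerA -scalerDr scaleNr.
    have -> : z 0 e1 *: A0 y0 + z 0 ord_max *: A1 y0 = - (z 0 e0 *: v).
      by apply/eqP; rewrite -addr_eq0 addrC addrA E.
    by rewrite scalerN opprK scalerA mulVf // scale1r.
  move: E; rewrite z00 scale0r add0r => /ind[z1 z2].
  by apply/rowP; apply: ord3P; rewrite mxE.
have [d d0 dB] := det_neq0_near B0.
have [r r0 hr] : exists2 r : R, 0 < r & forall y, ball y0 r y ->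
    [/\ transition_dom b c y, ball (A0 y0) d (A0 y) & ball (A1 y0) d (A1 y)].
  have : \forall y \near y0, [/\ transition_dom b c y, ball (A0 y0) d (A0 y) & ball (A1 y0) d (A1 y)].
    near=> y; split; near: y.
    - have h := chart_near cb bp (chart_dom_near cc cp).
      apply: filterS h => y [h1 h2]; split=> //.
    - by apply: (cA0 (ball (A0 y0) d)); exact: nbhsx_ballx.
    - by apply: (cA1 (ball (A1 y0) d)); exact: nbhsx_ballx.
  by move=> /nbhs_ballP[r r0 hr]; exists r.
have [q q0 hq] : exists2 q : R, 0 < q & forall x, ball (cmap c p) q x ->
    [/\ ccod c x, cdom b (cinv c x) & ball y0 r (cmap b (cinv c x))].
  have bn : nbhs p [set m | cdom b m /\ ball y0 r (cmap b m)].
    apply: filterI; first exact: chart_dom_near.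
    by apply: (b3 p bp (ball y0 r)); exact: nbhsx_ballx.
  have := chart_near cc cp bn.
  by move=> /nbhs_ballP[q q0 hq]; exists q => // x /hq[? []].
pose e := Num.min (Num.min 1 d) (q / (`|v| + 2)).
have v2 : 0 < `|v| + 2 by rewrite ltr_wpDl.
have e0' : 0 < e by rewrite /e !lt_min ltr01 d0 divr_gt0.
have ed : e <= d by rewrite /e !ge_min lexx orbT.
have e1' : e <= 1 by rewrite /e !ge_min lexx.
have eq : e * (`|v| + 2) <= q by rewrite -ler_pdivlMr // /e !ge_min lexx orbT.
have eq' : e <= q.
  by apply: le_trans eq; rewrite ler_peMr ?(ltW e0') //; have := normr_ge0 v; lra.
exists e => // x w t bx bw /andP[t0 te] hE.
have bxt : ball (cmap c p) q (x + t *: w).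
  by apply: step_ball bx bw _ => //; rewrite !ltW.
have [xc xb xr] := hq _ (le_ball eq' bx); have [xc' xb' xr'] := hq _ bxt.
pose y := cmap b (cinv c x); pose y' := cmap b (cinv c (x + t *: w)).
have Py : Phi y = x by rewrite /Phi /transition /= (b1 _ xb).2 (c2 _ xc).2.
have Py' : Phi y' = x + t *: w by rewrite /Phi /transition /= (b1 _ xb').2 (c2 _ xc').2.
pose a0 := y' 0 e0 - y 0 e0; pose a1 := y' 0 e1 - y 0 e1.
pose y'' := y + a0 *: delta_mx 0 e0.
have [y''0 y''1 y''2] : [/\ y'' 0 e0 = y' 0 e0, y'' 0 e1 = y 0 e1 & y'' 0 ord_max = y 0 ord_max].
  exact: shift_e0.
have y'E : y' = y'' + a1 *: delta_mx 0 e1 by exact: shift_e0_e1.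
(* The corner takes each coordinate from [y] or from [y'], and balls for the sup norm are products
   of intervals. *)
have br'' : ball y0 r y''.
  case: xr xr' => _ yr [_ yr']; split=> // i; rewrite (ord1 i).
  apply: ord3P; rewrite ?y''0 ?y''1 ?y''2; [exact: yr' | exact: yr | exact: yr].
have mvt0 j : exists z : 'rV[R]_3, ball y0 r z /\ (Phi y'' - Phi y) 0 j = a0 * (A0 z) 0 j.
  have [z /hr[zd _ _]|||z zr E] := @partial_MVT R 3 Phi y0 y e0 j r a0.
  - by have [/(_ e0 (or_introl erefl))[]] := fol_C1 Fb Ac zd.
  - exact: xr.
  - exact: br''.
  - by exists z; split=> //; rewrite E -A0E.
have mvt1 j : exists z : 'rV[R]_3, ball y0 r z /\ (Phi y' - Phi y'') 0 j = a1 * (A1 z) 0 j.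
  have [z /hr[zd _ _]|||z zr E] := @partial_MVT R 3 Phi y0 y'' e1 j r a1.
  - by have [/(_ e1 (or_intror erefl))[]] := fol_C1 Fb Ac zd.
  - exact: br''.
  - by rewrite -y'E; exact: xr'.
  - by exists z; split=> //; rewrite y'E E -A1E.
have /choice[xi xiP] := mvt0; have /choice[xi' xi'P] := mvt1.
have : \det (B w xi xi') != 0.
  have bd : ball v d w by apply: le_ball bw.
  apply: dB => i j; move: i; apply: ord3P.
  - by have [-> _ _] := rows3E (fun j => v 0 j) (fun j => A0 y0 0 j) (fun j => A1 y0 0 j) j;
      have [-> _ _] := rows3E (fun j => w 0 j) (fun j => A0 (xi j) 0 j) (fun j => A1 (xi' j) 0 j) j;
      case: bd => _; exact.
  - have [_ -> _] := rows3E (fun j => v 0 j) (fun j => A0 y0 0 j) (fun j => A1 y0 0 j) j.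
    have [_ -> _] := rows3E (fun j => w 0 j) (fun j => A0 (xi j) 0 j) (fun j => A1 (xi' j) 0 j) j.
    by have [_ [_ h] _] := hr _ (xiP j).1; exact: h.
  - have [_ _ ->] := rows3E (fun j => v 0 j) (fun j => A0 y0 0 j) (fun j => A1 y0 0 j) j.
    have [_ _ ->] := rows3E (fun j => w 0 j) (fun j => A0 (xi j) 0 j) (fun j => A1 (xi' j) 0 j) j.
    by have [_ _ [_ h]] := hr _ (xi'P j).1; exact: h.
(* On a common plaque, the row [(t, - a0, - a1)] would be in the kernel, and it is non-zero because
   [t > 0]. *)
move=> /det0P; apply; exists (\row_i nth 0 [:: t; - a0; - a1] i).
  apply/eqP => /rowP/(_ ord0); rewrite !mxE /= => t00.
  by move: t0; rewrite t00 ltxx.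
apply/rowP => j; rewrite mul_rows3 [RHS]mxE !mxE /= !inordK //= !mulNr.
have [_ <-] := xiP j; have [_ <-] := xi'P j.
by rewrite Py Py'; move: (Phi y'') => z; rewrite !mxE; ring.
Unshelve. all: by end_near. Qed.

Lemma height_continuous (b c : chart R M) x : is_chart b -> is_chart c ->
  ccod c x -> cdom b (cinv c x) -> {for x, continuous (height b \o cinv c)}.
Proof.
move=> [_ _ _ b3 _] [_ _ _ _ c4] cx bx.
apply: (@continuous_comp _ _ _ (cinv c) (height b)); first exact: c4.
apply: (@continuous_comp _ _ _ (cmap b) (fun y : 'rV[R]_3 => y 0 ord_max)); first exact: b3.
exact: coord_continuous.
Qed.

(** By [leafwise_noncrossing] the height increment does not vanish on a convex set of triples
    [(x, w, t)]. It is continuous along the straight path from a reference triple, so its sign is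
    constant. *)
Lemma upward_exists (b c : chart R M) (p : M) (v : 'rV[R]_3) :
  fol_atlas F b -> atlas c -> cdom b p -> cdom c p -> ~ leaf_tangent_plane F p c v ->
  exists2 s : int, s = 1 \/ s = -1 & upward b c p v s.
Proof.
move=> Fb Ac bp cp vT; have [d d0 hd] := leafwise_noncrossing Fb Ac bp cp vT.
have cb := (fol_chart Fb).1; have cc := atlas_chart Ac.
have [q q0 hq] : exists2 q : R, 0 < q & forall x, ball (cmap c p) q x ->
    ccod c x /\ cdom b (cinv c x).
  have := chart_near cc cp (chart_dom_near cb bp).
  by move=> /nbhs_ballP[q q0 hq]; exists q => // x /hq.
pose e := Num.min (Num.min 1 d) (q / (`|v| + 2)).
have v2 : 0 < `|v| + 2 by rewrite ltr_wpDl.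
have e0' : 0 < e by rewrite /e !lt_min ltr01 d0 divr_gt0.
have ed : e <= d by rewrite /e !ge_min lexx orbT.
have e1' : e <= 1 by rewrite /e !ge_min lexx.
have eq : e * (`|v| + 2) <= q by rewrite -ler_pdivlMr // /e !ge_min lexx orbT.
have eq' : e <= q.
  by apply: le_trans eq; rewrite ler_peMr ?(ltW e0') //; have := normr_ge0 v; lra.
pose x0 := cmap c p; pose h := height b \o cinv c.
pose G (x w : 'rV[R]_3) (t : R) := h (x + t *: w) - h x.
have G0 x w t : ball x0 e x -> ball v e w -> 0 < t < e -> G x w t != 0.
  move=> bx bw /andP[t0 te]; rewrite subr_eq0; apply/eqP; apply: hd.
  - exact: le_ball bx.
  - exact: le_ball bw.
  - by rewrite t0 (lt_le_trans te).
have bx0 : ball x0 e x0 by exact: ballxx.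
have bv : ball v e v by exact: ballxx.
have e2 : 0 < e / 2 < e by lra.
exists (sgz (G x0 v (e / 2))).
  have := G0 x0 v (e / 2) bx0 bv e2; rewrite neq_lt => /orP[g0|g0].
    by right; rewrite ltr0_sgz.
  by left; rewrite gtr0_sgz.
exists e => // x w t bx bw te.
pose X (k : R) := x0 + k *: (x - x0); pose W (k : R) := v + k *: (w - v).
pose T (k : R) := e / 2 + k * (t - e / 2).
have bX k : 0 <= k <= 1 -> ball x0 e (X k).
  move=> /andP[k0 k1]; move: bx; rewrite -!ball_normE /= => bx.
  apply: le_lt_trans bx; rewrite /X opprD addrA subrr add0r normrN normrZ distrC.
  by rewrite ler_piMl ?normr_ge0 // ger0_norm.
have bW k : 0 <= k <= 1 -> ball v e (W k).
  move=> /andP[k0 k1]; move: bw; rewrite -!ball_normE /= => bw.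
  apply: le_lt_trans bw; rewrite /W opprD addrA subrr add0r normrN normrZ distrC.
  by rewrite ler_piMl ?normr_ge0 // ger0_norm.
have bT k : 0 <= k <= 1 -> 0 < T k < e.
  by move=> /andP[k0 k1]; case/andP: te => t0 te; rewrite /T; nra.
pose P (k : R) := sgz (G (X k) (W k) (T k)) = sgz (G x0 v (e / 2)).
have : P 1.
  apply: (@segment_ind R P 0 1) => //; last first.
    by rewrite /P /X /W /T !scale0r !mul0r !addr0.
  move=> k k0 k1; have k01 : 0 <= k <= 1 by rewrite k0.
  have lin (y z : 'rV[R]_3) : continuous (fun k : R => y + k *: z).
    by move=> l; apply: cvgD; [exact: cvg_cst | apply: cvgZl; exact: cvg_id].
  have cX : {for k, continuous X} by exact: lin.
  have cT : {for k, continuous T}.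
    by apply: cvgD; [exact: cvg_cst | apply: cvgM; [exact: cvg_id | exact: cvg_cst]].
  have cXT : {for k, continuous (fun k => X k + T k *: W k)}.
    by apply: cvgD => //; apply: cvgZ => //; exact: lin.
  have [hc1 hb1] := hq _ (le_ball eq' (bX k k01)).
  have [hc2 hb2] : ccod c (X k + T k *: W k) /\ cdom b (cinv c (X k + T k *: W k)).
    apply: hq; apply: step_ball (bX k k01) (bW k k01) _ => //.
    by case/andP: (bT k k01) => ? ?; rewrite !ltW.
  have cG : {for k, continuous (fun k => G (X k) (W k) (T k))}.
    apply: cvgB.
      apply: (@continuous_comp _ _ _ (fun k => X k + T k *: W k) h) => //.
      exact: height_continuous.
    by apply: (@continuous_comp _ _ _ X h) => //; exact: height_continuous.
  have := sgz_near cG (G0 _ _ _ (bX k k01) (bW k k01) (bT k k01)).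
  by apply: filterS => l E _ _; rewrite /P E.
rewrite /P /X /W /T !scale1r !mul1r ![_ + (_ - _)]addrC !subrK.
exact.
Qed.

Lemma upward_near (b c : chart R M) (p : M) (v : 'rV[R]_3) (s : int) :
  is_chart c -> cdom c p -> upward b c p v s ->
  exists2 e : R, 0 < e & \forall p' \near p, forall v', ball v e v' -> upward b c p' v' s.
Proof.
move=> [_ _ _ c3 _] cp [e e0 he]; exists (e / 2); first by rewrite divr_gt0.
have : nbhs p [set p' | ball (cmap c p) (e / 2) (cmap c p')].
  by apply: (c3 p cp (ball (cmap c p) (e / 2))); apply: nbhsx_ballx; rewrite divr_gt0.
apply: filterS => p' pp' v' vv'; exists (e / 2); first by rewrite divr_gt0.
move=> x w t px vw /andP[t0 te]; apply: he.
- by rewrite [e]splitr; exact: ball_triangle px.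
- by rewrite [e]splitr; exact: ball_triangle vw.
- by rewrite t0 (lt_trans te) // ltr_pdivrMr // mulr2n mulrDr mulr1 ltrDl.
Qed.

Lemma upward_curve (b c : chart R M) (zeta : R -> M) (t0 : R) (s : int) :
  is_chart c -> cdom c (zeta t0) -> {for t0, continuous zeta} ->
  derivable (cmap c \o zeta) t0 1 ->
  upward b c (zeta t0) ('D_1 (cmap c \o zeta) t0) s ->
  \forall t \near t0, sgz (height b (zeta t) - height b (zeta t0)) = sgz (t - t0) * s.
Proof.
move=> cc cp cz dz [e e0 he]; have [_ c1 _ c3 _] := cc.
have /= hw := derivable_quotient dz e0.
have hx : \forall t \near t0, ball (cmap c (zeta t0)) e (cmap c (zeta t)).
  have h : nbhs (zeta t0) [set m | ball (cmap c (zeta t0)) e (cmap c m)].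
    by apply: (c3 _ cp (ball (cmap c (zeta t0)) e)); exact: nbhsx_ballx.
  exact: (cz _ h).
have hd : \forall t \near t0, cdom c (zeta t).
  exact: (cz _ (chart_dom_near cc cp)).
have ht : \forall t \near t0, ball t0 e t by exact: nbhsx_ballx.
near=> t.
have bt : ball t0 e t by near: t.
have bx : ball (cmap c (zeta t0)) e (cmap c (zeta t)) by near: t.
have dt : cdom c (zeta t) by near: t.
have : t != t0 -> ball ('D_1 (cmap c \o zeta) t0) e
    ((t - t0)^-1 *: (cmap c (zeta t) - cmap c (zeta t0))) by near: t.
set w := (t - t0)^-1 *: (cmap c (zeta t) - cmap c (zeta t0)) => bw.
have [tt|tt|->] := ltgtP t t0; last by rewrite !subrr sgz0 mul0r.
(* Before [t0] the increment is read backwards: the base point is the nearby point [zeta t], and the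
   step [t0 - t] leads to [zeta t0]. *)
- have tn : t - t0 != 0 by rewrite subr_eq0 lt_eqF.
  have := he _ _ (t0 - t) bx (bw (negbT (lt_eqF tt))) _.
  have -> : cmap c (zeta t) + (t0 - t) *: w = cmap c (zeta t0).
    by rewrite /w scalerA -opprB mulNr divff // scaleN1r opprB addrC subrK.
  rewrite (c1 _ dt).2 (c1 _ cp).2 => h.
  have : sgz (height b (zeta t0) - height b (zeta t)) = s.
    by apply: h; move: bt; rewrite /ball /= ltr_norml; lra.
  move=> <-; rewrite -[X in sgz X = _]opprB sgzN.
  by rewrite (@ltr0_sgz _ (t - t0)) ?subr_lt0 // mulN1r.
- have tn : t - t0 != 0 by rewrite subr_eq0 gt_eqF.
  have bx0 : ball (cmap c (zeta t0)) e (cmap c (zeta t0)) by exact: ballxx.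
  have := he _ _ (t - t0) bx0 (bw _) _.
  have -> : cmap c (zeta t0) + (t - t0) *: w = cmap c (zeta t).
    by rewrite /w scalerA divff // scale1r addrC subrK.
  rewrite (c1 _ dt).2 (c1 _ cp).2 (@gtr0_sgz _ (t - t0)) ?subr_gt0 // mul1r; apply.
    by rewrite gt_eqF.
  by move: bt; rewrite /ball /= ltr_norml; lra.
Unshelve. all: by end_near. Qed.

End Upward.

(** * Sides of a compact leaf *)

Section Orientation.
Context {R : realType} {M : manifold3 R} (F : foliation M).
Context (X : M -> chart R M -> 'rV[R]_3).

Lemma chart_line (c c' : chart R M) (p : M) (v : 'rV[R]_3) :
  atlas c -> atlas c' -> cdom c p -> cdom c' p ->
  let zeta t := cinv c (cmap c p + t *: v) in
  derivable (cmap c' \o zeta) 0 1 /\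
  'D_1 (cmap c' \o zeta) 0 = 'd (transition c c') (cmap c p) v.
Proof.
move=> Ac Ac' cp cp' zeta; have [_ c1 _ _ _] := atlas_chart Ac; have [cc ci] := c1 p cp.
have df : differentiable (transition c c') (cmap c p).
  have [h _] := atlas_smooth Ac Ac' 1; apply: h.
  by split=> //=; rewrite ci.
have E : (fun h : R => h^-1 *: (((cmap c' \o zeta) \o shift 0) (h *: 1) - (cmap c' \o zeta) 0)) =
  (fun h : R => h^-1 *: ((transition c c' \o shift (cmap c p)) (h *: v) - transition c c' (cmap c p))).
  apply/funext => h; rewrite /zeta /transition /=.
  by rewrite scale0r addr0 [h%:A]mulr1 addr0 [_ + h *: v]addrC.
split; first by rewrite /derivable E; exact: diff_derivable.
by rewrite -deriveE // /derive E.
Qed.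

(** The sign [s] tells whether the height in [b] increases along [X] near [p]; multiplying height
    differences by it makes foliated charts comparable. *)
Record oriented (p : M) (b c : chart R M) (s : int) : Prop := Oriented {
  oriented_fol : fol_atlas F b;
  oriented_atlas : atlas c;
  oriented_fdom : cdom b p;
  oriented_dom : cdom c p;
  oriented_sign : s = 1 \/ s = -1;
  oriented_upward : upward b c p (X p c) s }.

Hypothesis X_orient : transverse_orientation F X.

Lemma oriented_exists p : exists z : chart R M * chart R M * int,
  oriented p z.1.1 z.1.2 z.2.
Proof.
have [_ _ Xt] := X_orient.
have [b Fb bp] := fol_covers F p; have [c Ac cp] := atlas_covers p.
have [s s1 up] := upward_exists Fb Ac bp cp (Xt p c Ac cp).
by exists (b, c, s); split.
Qed.

Lemma oriented_near p b c s : oriented p b c s -> \forall p' \near p, oriented p' b c s.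
Proof.
move=> [Fb Ac bp cp s1 up]; have [[_ cX] _ _] := X_orient.
have cb := (fol_chart Fb).1; have cc := atlas_chart Ac.
have [e e0 upn] := upward_near cc cp up.
have hX : \forall p' \near p, ball (X p c) e (X p' c).
  by apply: (cX c Ac p cp (ball (X p c) e)); exact: nbhsx_ballx.
near=> p'; split=> //.
- by near: p'; exact: chart_dom_near.
- by near: p'; exact: chart_dom_near.
- have h : ball (X p c) e (X p' c) by near: p'.
  by move: h; move: (X p' c); near: p'.
Unshelve. all: by end_near. Qed.

Lemma sqr_sign (s : int) : s = 1 \/ s = -1 -> s * s = 1.
Proof. by case=> ->. Qed.

Lemma coherent_near p b b' : fol_atlas F b -> fol_atlas F b' -> cdom b p -> cdom b' p ->
  exists2 W, nbhs p W & forall q q', W q -> W q' ->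
    height b q = height b q' <-> height b' q = height b' q'.
Proof.
move=> Fb Fb' bp bp'; have [W nW hW] := fol_coherent Fb Fb' bp bp'.
have [W' nW' hW'] := fol_coherent Fb' Fb bp' bp.
exists (W `&` W'); first exact: filterI.
by move=> q q' [? ?] [? ?]; split; [exact: hW | exact: hW'].
Qed.

(* Near [p] a point is on the plaque (for both charts) of a point of the line
   directed by [X], along which both heights are monotone. *)
Lemma oriented_consistent p b c s b' c' s' : oriented p b c s -> oriented p b' c' s' ->
  \forall x \near p,
    sgz (height b x - height b p) * s = sgz (height b' x - height b' p) * s'.
Proof.
move=> [Fb Ac bp cp s1 up] [Fb' Ac' bp' cp' s1' up']; have [[Xv _] _ _] := X_orient.
have cb := (fol_chart Fb).1; have cc := atlas_chart Ac; have cc' := atlas_chart Ac'.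
have [[_ occ] c1 c2 c3 c4] := cc; have [ccp cip] := c1 p cp.
pose zeta (t : R) := cinv c (cmap c p + t *: X p c).
have z0 : zeta 0 = p by rewrite /zeta scale0r addr0.
have cline : continuous (fun t : R => cmap c p + t *: X p c).
  by move=> l; apply: cvgD; [exact: cvg_cst | apply: cvgZl; exact: cvg_id].
have zc t : ccod c (cmap c p + t *: X p c) -> {for t, continuous zeta}.
  move=> ct; apply: (@continuous_comp _ _ _ (fun t : R => cmap c p + t *: X p c) (cinv c)).
    exact: cline.
  exact: c4.
have zc0 : {for 0, continuous zeta} by apply: zc; rewrite scale0r addr0.
have crv b1 c1' s2 : is_chart c1' -> atlas c1' -> cdom c1' p -> upward b1 c1' p (X p c1') s2 ->
    \forall t \near (0 : R), sgz (height b1 (zeta t) - height b1 p) = sgz t * s2.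
  move=> cc1 Ac1 cp1 up1; have [dz Dz] := chart_line (X p c) Ac Ac1 cp cp1.
  have := @upward_curve _ _ b1 c1' zeta 0 s2 cc1.
  rewrite z0 Dz -(Xv p c c1' Ac Ac1 cp cp1) => /(_ cp1 zc0 dz up1).
  by apply: filterS => t; rewrite subr0.
have near1 := crv b c s cc Ac cp up; have near2 := crv b' c' s' cc' Ac' cp' up'.
have [W nW hW] := coherent_near Fb Fb' bp bp'.
have nearW : \forall t \near (0 : R), W (zeta t) by apply: (zc0 W); rewrite z0.
have nearc : \forall t \near (0 : R), {for t, continuous (height b \o zeta)}.
  have h1 : \forall t \near (0 : R), ccod c (cmap c p + t *: X p c).
    by apply: (cline 0 (ccod c)); apply: open_nbhs_nbhs; rewrite scale0r addr0.
  have h2 : \forall t \near (0 : R), cdom b (zeta t).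
    by apply: (zc0 (cdom b)); rewrite z0; exact: chart_dom_near.
  near=> t; apply: (@continuous_comp _ _ _ (fun t : R => cmap c p + t *: X p c) (height b \o cinv c)).
    exact: cline.
  by apply: height_continuous => //; near: t.
have [d d0 hd] : exists2 d : R, 0 < d & forall t, ball 0 d t ->
    [/\ sgz (height b (zeta t) - height b p) = sgz t * s,
      sgz (height b' (zeta t) - height b' p) = sgz t * s',
      W (zeta t) & {for t, continuous (height b \o zeta)}].
  have : \forall t \near (0 : R), [/\ sgz (height b (zeta t) - height b p) = sgz t * s,
      sgz (height b' (zeta t) - height b' p) = sgz t * s',
      W (zeta t) & {for t, continuous (height b \o zeta)}].
    by near=> t; split; near: t.
  by move=> /nbhs_ballP[d d0 hd]; exists d.
pose t1 := d / 2; have t10 : 0 < t1 by rewrite divr_gt0.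
have t1d : t1 < d by rewrite /t1; lra.
have bt t : - t1 <= t <= t1 -> ball 0 d t.
  by rewrite /ball /= sub0r normrN ltr_norml; lra.
have [g1 _ _ _] := hd t1 (bt t1 ltac:(lra)).
have [g2 _ _ _] := hd (- t1) (bt (- t1) ltac:(lra)).
have chb : {for p, continuous (height b)}.
  have [_ _ _ b3 _] := cb.
  apply: (@continuous_comp _ _ _ (cmap b) (fun y : 'rV[R]_3 => y 0 ord_max)); first exact: b3.
  exact: coord_continuous.
have lohi : Num.min (height b (zeta (- t1))) (height b (zeta t1)) < height b p
    < Num.max (height b (zeta (- t1))) (height b (zeta t1)).
  move: g1 g2; rewrite (gtr0_sgz t10) (@ltr0_sgz _ (- t1)) ?oppr_lt0 // mul1r mulN1r => g1 g2.
  rewrite gt_min lt_max; case: s1 => s1; rewrite s1 in g1 g2.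
    move/eqP: g1; move/eqP: g2; rewrite sgz_cp0 sgz_cp0 subr_gt0 subr_lt0 => -> ->.
    by rewrite orbT.
  move/eqP: g1; move/eqP: g2; rewrite opprK sgz_cp0 sgz_cp0 subr_gt0 subr_lt0 => -> ->.
  by rewrite orbT.
have hx : \forall x \near p, Num.min (height b (zeta (- t1))) (height b (zeta t1)) < height b x
    < Num.max (height b (zeta (- t1))) (height b (zeta t1)).
  case/andP: lohi => lo hi.
  have h1 : nbhs p [set x | Num.min (height b (zeta (- t1))) (height b (zeta t1)) < height b x].
    by apply: (chb [set z | _ < z]); exact: lt_nbhsr.
  have h2 : nbhs p [set x | height b x < Num.max (height b (zeta (- t1))) (height b (zeta t1))].
    by apply: (chb [set z | z < _]); exact: lt_nbhsl.
  by apply: filterS2 h1 h2 => x ? ?; apply/andP.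
near=> x.
have Wx : W x by near: x.
have Wp : W p by exact: nbhs_singleton.
have /andP[lx rx] : Num.min (height b (zeta (- t1))) (height b (zeta t1)) < height b x
    < Num.max (height b (zeta (- t1))) (height b (zeta t1)) by near: x.
have [|||t] := @IVT R (height b \o zeta) (- t1) t1 (height b x).
- by move: t10; lra.
- apply: continuous_in_subspaceT => t; rewrite inE /= in_itv /= => tt.
  by have [_ _ _] := hd t (bt t tt).
- by rewrite !ltW.
rewrite in_itv /= => tt E; have [e1 e2 Wt _] := hd t (bt t tt).
have E' : height b' (zeta t) = height b' x by apply/(hW _ _ Wt Wx).
rewrite -E -E' /= e1 e2 -!mulrA !sqr_sign //.
Unshelve. all: by end_near. Qed.

Lemma height_near (b : chart R M) (p : M) : is_chart b -> cdom b p ->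
  {for p, continuous (height b)}.
Proof.
move=> [_ _ _ b3 _] bp.
apply: (@continuous_comp _ _ _ (cmap b) (fun y : 'rV[R]_3 => y 0 ord_max)); first exact: b3.
exact: coord_continuous.
Qed.

(** By coherence, near a point common to two plaques both heights have the same level sets, so there
    the second plaque is contained in the first. The open set is the union of these
    neighbourhoods. *)
Lemma plaque_leafwise_open (b : chart R M) (z : R) : fol_atlas F b ->
  @open (leafwise F) (plaque b z).
Proof.
move=> Fb; suff : @leafwise_open R M F (plaque b z) by [].
move=> b' z' Fb'.
pose D := [set p | plaque b z p /\ plaque b' z' p].
have W p : exists W : set M, [/\ open W, D p -> W p &
    forall q, D p -> W q -> plaque b' z' q -> plaque b z q].
  have [[[bp bz] [bp' bz']]|nD] := pselect (D p); last by exists setT; split=> //; exact: openT.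
  have [W nW hW] := coherent_near Fb Fb' bp bp'.
  have nb : nbhs p (W `&` cdom b) by apply: filterI => //; exact: chart_dom_near (fol_chart Fb).1 bp.
  exists (interior (W `&` cdom b)); split; [exact: open_interior | by move=> _ |].
  move=> q _ /interior_subset[Wq bq] [bq' qz']; split=> //.
  have Wp : W p by exact: nbhs_singleton.
  by rewrite -bz; apply/(hW _ _ Wq Wp); rewrite qz' bz'.
have /choice[V VP] := W.
exists (\bigcup_(p in D) V p).
  by apply: bigcup_open => p _; have [] := VP p.
move=> q bq'; split=> [bq|[p Dp Vq]]; last by have [_ _ /(_ q Dp Vq bq')] := VP p.
have Dq : D q by split.
by exists q => //; have [_ /(_ Dq)] := VP q.
Qed.

Lemma open_leafwise (V : set M) : open V -> @open (leafwise F) V.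
Proof.
move=> oV; suff : @leafwise_open R M F V by [].
by move=> b z _; exists V.
Qed.

(* The trace on [D] of the neighbourhoods of [p] in [M] clusters in [L] for the
   leaf topology, which is finer, hence at [p]. *)
Lemma compact_leaf_limit (L D : set M) (p : M) : hausdorff_space M -> compact_leaf F L ->
  D `<=` L -> closure D p ->
  L p /\ forall U : set M, @open (leafwise F) U -> U p -> (D `&` U) !=set0.
Proof.
move=> hM [_ cL] DL clD.
pose G : set_system (leafwise F) := within D (nbhs p).
have PM : @ProperFilter M (within D (nbhs p)).
  apply: Build_ProperFilter_ex => A; rewrite /within /= => nA.
  by have [x [Dx Ax]] := clD _ nA; exists x; exact: Ax.
have PG : ProperFilter G := PM.
have GL : G L by apply: (@filterE M (nbhs p)) => x /DL.
have [q [Lq qG]] := cL G PG GL.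
have pq : p = q.
  apply: hM => A B nA nB.
  have GA : G A by apply: (@filterS M (nbhs p) _ _ _ _ nA) => x Ax _.
  have oB := open_leafwise (@open_interior M B).
  have nI : @nbhs _ (leafwise F) q (@interior M B) by apply: open_nbhs_nbhs; split.
  have [x [Ax Bx]] := qG A _ GA nI.
  by exists x; split=> //; exact: (@interior_subset M B).
rewrite -pq in Lq qG; split=> // U oU Up.
have GD : G D by apply: (@filterE M (nbhs p)) => x.
by apply: (qG D U GD); apply: open_nbhs_nbhs.
Qed.

Section CompactLeaf.
Context (L : set M).
Hypotheses (M_hausdorff : hausdorff_space M) (L_compact : compact_leaf F L).

Lemma compact_leaf_closed : closed L.
Proof. by move=> p /(compact_leaf_limit M_hausdorff L_compact (@subset_refl _ L))[]. Qed.

Lemma plaque_sub_leaf (b : chart R M) (p q : M) : fol_atlas F b -> cdom b p -> cdom b q ->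
  height b q = height b p -> L p -> L q.
Proof.
move=> Fb bp bq E; have [[p0 ->] _] := L_compact => Lp.
apply: rt_trans Lp _; apply: rt_step; exists b, (height b p); split=> //.
Qed.

(** A compact leaf does not accumulate on itself: the plaque of [p] is a neighbourhood of [p] in the
    leaf topology that misses the rest [D] of the leaf, so [p] is not in the closure of [D]. *)
Lemma leaf_near (b : chart R M) (p : M) : fol_atlas F b -> cdom b p -> L p ->
  \forall x \near p, L x <-> height b x = height b p.
Proof.
move=> Fb bp Lp.
pose D := L `\` plaque b (height b p).
have nD : ~ closure D p.
  move=> /(compact_leaf_limit M_hausdorff L_compact (@subDsetl _ _ _))[_].
  move=> /(_ _ (plaque_leafwise_open (height b p) Fb)) [|x [[_ nx] px]]; first by split.
  exact: nx.
have cb := (fol_chart Fb).1.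
have h1 : nbhs p (~` D).
  apply: contrapT => nn; apply: nD => B nB; apply: contrapT => nI; apply: nn.
  by apply: filterS nB => x Bx Dx; apply: nI; exists x.
have h2 := chart_dom_near cb bp.
near=> x; have bx : cdom b x by near: x.
split=> [Lx|E]; last exact: (plaque_sub_leaf Fb bp bx E Lp).
apply: contrapT => nE; have : (~` D) x by near: x.
by apply; split=> // -[_].
Unshelve. all: by end_near. Qed.

Definition frame (p : M) : chart R M * chart R M * int := projT1 (cid (oriented_exists p)).

Lemma frameP p : oriented p (frame p).1.1 (frame p).1.2 (frame p).2.
Proof. exact: projT2 (cid (oriented_exists p)). Qed.

(** Only the germ at [p] is meaningful: by [sideE] it is independent of the chosen frame. *)
Definition side (p x : M) : int :=
  sgz (height (frame p).1.1 x - height (frame p).1.1 p) * (frame p).2.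

Lemma sideE p b c s : oriented p b c s ->
  \forall x \near p, side p x = sgz (height b x - height b p) * s.
Proof. by move=> o; apply: oriented_consistent o; exact: frameP. Qed.

(* Crossing [L] contributes twice: when reaching it and when leaving it. *)
Definition crossing (p x : M) : rat := if `[< L p >] then (side p x)%:~R else 0.

Lemma crossing_on p x : L p -> crossing p x = (side p x)%:~R.
Proof. by move=> Lp; rewrite /crossing asboolT. Qed.

Lemma crossing_off p x : ~ L p -> crossing p x = 0.
Proof. by move=> Lp; rewrite /crossing asboolF. Qed.

(** Near a point off the leaf everything vanishes, since the leaf is closed. Near a point [p] of the
    leaf, a point [q] of the leaf has the height of [p] and admits the same frame, so the two sides
    agree; if [q] is off the leaf, its height differs from that of [p], and the side with respect to
    [p] is constant near [q]. *)
Lemma crossing_cocycle : cocycle crossing.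
Proof.
move=> p; have [Lp|nLp] := pselect (L p); last first.
  have : nbhs p (~` L) by apply: open_nbhs_nbhs; split=> //; exact/closed_openC/compact_leaf_closed.
  apply: filterS => q nLq; apply: nearW => x.
  by rewrite !crossing_off // addr0.
have o := frameP p; have [Fb Ac bp cp s1 up] := o; set b := (frame p).1.1 in o Fb bp up.
have cb := (fol_chart Fb).1.
near=> q.
have oq : oriented q b (frame p).1.2 (frame p).2 by near: q; exact: oriented_near.
have Lq : L q <-> height b q = height b p by near: q; exact: leaf_near.
have bq : cdom b q by near: q; exact: chart_dom_near.
have [/[dup] lq /Lq E|nlq] := pselect (L q).
  have := sideE oq; apply: filterS => x Ex.
  by rewrite !crossing_on // Ex /side -/b E subrr sgz0 mul0r add0r.
have hn : height b q - height b p != 0 by rewrite subr_eq0; apply/eqP => /Lq.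
have ch : {for q, continuous (fun x => height b x - height b p)}.
  by apply: cvgB; [exact: height_near | exact: cvg_cst].
apply: filterS (sgz_near ch hn) => x E.
by rewrite !(crossing_on _ Lp) crossing_off // addr0 /side -/b E.
Unshelve. all: by end_near. Qed.

End CompactLeaf.

(** The sign is a product: [s'] compares the velocity of the loop with the heights of [b], and [s]
    compares [X] with them. *)
Lemma loop_direction_local (g : R -> M) (t : R) : embedded_transverse_loop F g ->
  exists2 s : int, s = 1 \/ s = -1 & \forall t' \near t, \forall u \near t',
    side (g t') (g u) = sgz (u - t') * s.
Proof.
move=> [_ _ [cg C1g] tg].
have o := frameP (g t); have [Fb Ac bp cp s1 up] := o.
set b := (frame (g t)).1.1 in o Fb bp up; set c := (frame (g t)).1.2 in o Ac cp up.
set s := (frame (g t)).2 in o s1 up.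
have cc := atlas_chart Ac.
have [s' s1' up'] := upward_exists Fb Ac bp cp (tg t c Ac cp).
exists (s' * s); first by case: s1 s1' => -> [] ->; rewrite ?mulrN1 ?opprK ?mul1r; [left|right|right|left].
have [e e0 upn] := upward_near cc cp up'.
have [_ cv] := C1g c t Ac cp.
have h1 : \forall t' \near t, ball (velocity g t c) e (velocity g t' c).
  by apply: (cv (ball (velocity g t c) e)); exact: nbhsx_ballx.
have h2 : \forall t' \near t, forall v', ball (velocity g t c) e v' -> upward b c (g t') v' s'.
  exact: (cg t _ upn).
have h3 : \forall t' \near t, oriented (g t') b c s by exact: (cg t _ (oriented_near o)).
near=> t'.
have o' : oriented (g t') b c s by near: t'.
have up2 : upward b c (g t') (velocity g t' c) s'.
  have : forall v', ball (velocity g t c) e v' -> upward b c (g t') v' s' by near: t'.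
  by apply; near: t'.
have cp' := oriented_dom o'.
have [dg _] := C1g c t' Ac cp'.
rewrite /velocity derive1E in up2.
have n1 := upward_curve cc cp' (cg t') dg up2.
have n2 : \forall u \near t', side (g t') (g u) = sgz (height b (g u) - height b (g t')) * s.
  exact: (cg t' _ (sideE o')).
by near=> u; rewrite (near n2 u) // (near n1 u) // mulrA.
Unshelve. all: by end_near. Qed.

(** The direction is determined by the germ of the loop at each time and is locally constant, hence
    constant. All crossings therefore count with the same sign and cannot cancel. *)
Lemma loop_direction (g : R -> M) : embedded_transverse_loop F g ->
  exists2 s : int, s = 1 \/ s = -1 & forall t : R, 0 <= t <= 1 -> \forall u \near t,
    side (g t) (g u) = sgz (u - t) * s.
Proof.
move=> lg; have [s s1 hs] := loop_direction_local 0 lg.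
exists s => // t /andP[t0 t1].
pose P (t : R) := \forall u \near t, side (g t) (g u) = sgz (u - t) * s.
apply: (@segment_ind R P 0 t t0); last exact: nbhs_singleton hs.
move=> x _ _; have [s' _ hs'] := loop_direction_local x lg.
have uniq (y : R) : (\forall u \near y, side (g y) (g u) = sgz (u - y) * s') -> P y <-> s = s'.
  move=> hy; split=> [Py|E]; last by rewrite /P E.
  have : \forall u \near y, sgz (u - y) * s' = sgz (u - y) * s.
    by apply: filterS2 hy Py => u -> ->.
  move=> /nbhs_ballP[d /= d0 /(_ (y + d / 2))] h.
  have : ball y d (y + d / 2).
    by rewrite /ball /= opprD addrA subrr add0r normrN gtr0_norm; lra.
  move=> /h; have -> : y + d / 2 - y = d / 2 by rewrite addrC addKr.
  by rewrite gtr0_sgz ?divr_gt0 // !mul1r => ->.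
have hx := uniq x (nbhs_singleton hs').
by apply: filterS hs' => y hy _ _; rewrite hx (uniq y hy).
Qed.

End Orientation.

(** * The intersection number *)

Section Jumps.
Context {R : realType}.

(** [A] marks the points of the leaf: [G] rises by 1 on reaching one and by 1 on leaving it.
    Monotonicity is proved by connectedness, without counting the marked points, and the jump at [a]
    makes the increase strict. *)
Lemma jumps_increasing (G : R -> rat) (A : R -> bool) (a : R) :
  (forall x : R, 0 <= x <= 1 -> \forall y \near x, 0 <= y <= 1 ->
    G y = G x + (A x)%:R * (sgz (y - x))%:~R) ->
  0 <= a <= 1 -> A a -> G 0 < G 1.
Proof.
move=> jump /andP[a0 a1] Aa.
have mono (x z : R) : 0 <= x -> x <= z -> z <= 1 -> G x <= G z.
  (* The bound is carried over the whole segment from [x] to [t]: at a jump, [G x <= G t] alone does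
     not pass from a point to its neighbours. *)
  move=> x0 xz z1; pose P (t : R) := forall u : R, x <= u <= t -> G x <= G u.
  suff : P z by apply; rewrite xz lexx.
  apply: (@segment_ind R P x z xz); last by move=> u /le_anti ->.
  move=> y xy yz; have y01 : 0 <= y <= 1 by rewrite (le_trans x0) ?(le_trans yz).
  have /nbhs_ballP[d /= d0 hd] := jump y y01.
  apply/nbhs_ballP; exists d => //= w bw xw wz; split=> Pw u /andP[xu uw].
    have [uy|yu] := leP u y; first by apply: Pw; rewrite xu.
    have bu : ball y d u by move: bw; rewrite /ball /= !ltr_norml; lra.
    rewrite (hd u bu) ?(le_trans x0) ?(le_trans uw) ?(le_trans wz) //.
    rewrite gtr0_sgz ?subr_gt0 // mulr1.
    by apply: (le_trans (Pw y _)); rewrite ?xy ?lexx // lerDl ler0n.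
  have [uw'|wu] := leP u w; first by apply: Pw; rewrite xu.
  have bu : ball y d u by move: bw; rewrite /ball /= !ltr_norml; lra.
  have w01 : 0 <= w <= 1 by rewrite (le_trans x0) ?(le_trans wz).
  have wy : w < y by apply: lt_le_trans uw.
  have := Pw w; rewrite xw lexx => /(_ isT) /le_trans; apply.
  rewrite (hd w bw w01) ltr0_sgz ?subr_lt0 // mulrN1.
  rewrite (hd u bu) ?(le_trans x0) ?(le_trans uw) ?(le_trans yz) //.
  have [->|uy] := eqVneq u y; first by rewrite subrr sgz0 mulr0 addr0 gerBl ler0n.
  by rewrite ltr0_sgz ?mulrN1 // subr_lt0 lt_neqAle uy.
have a01 : 0 <= a <= 1 by rewrite a0.
have /nbhs_ballP[d /= d0 hd] := jump a a01.
(* Since [a] may be an end point, the strict jump is taken on its right if [a < 1], and on its left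
   if [a = 1]. *)
have [a1'|a1'] := ltP a 1.
  pose m := Num.min (a + d / 2) 1.
  have am : a < m by rewrite lt_min a1' ltrDl divr_gt0.
  have m1 : m <= 1 by rewrite ge_min lexx orbT.
  have bm : ball a d m.
    have : m <= a + d / 2 by rewrite ge_min lexx.
    by rewrite /ball /= ltr_norml; lra.
  have := hd m bm; rewrite m1 (le_trans a0 (ltW am)) => /(_ isT).
  rewrite gtr0_sgz ?subr_gt0 // Aa mulr1 mulr1n => E.
  have := mono 0 a (lexx _) a0 a1; have := mono m 1 (le_trans a0 (ltW am)) m1 (lexx _).
  by rewrite E; lra.
have {a1 a1'}aE : a = 1 by apply/eqP; rewrite eq_le a1.
pose m := Num.max (1 - d / 2) 0.
have m0 : 0 <= m by rewrite le_max lexx orbT.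
have ma : m < 1 by rewrite gt_max ltr01 andbT; lra.
have bm : ball a d m.
  have : 1 - d / 2 <= m by rewrite le_max lexx.
  by rewrite /ball /= aE ltr_norml; lra.
have := hd m bm; rewrite m0 (ltW ma) => /(_ isT).
rewrite Aa aE ltr0_sgz ?subr_lt0 // mulrN1 mulr1n => E.
by have := mono 0 m (lexx _) m0 (ltW ma); rewrite E; lra.
Qed.

Lemma periodicE (T : Type) (g : R -> T) : (forall t, g (t + 1) = g t) ->
  forall t, exists2 u, 0 <= u <= 1 & g u = g t.
Proof.
move=> per t.
have pern (n : nat) x : g (x + n%:R) = g x.
  by elim: n => [|n IH]; rewrite ?addr0 // -natr1 addrA per.
have perz (n : int) x : g (x + n%:~R) = g x.
  by case: n => n; rewrite ?pern // NegzE mulrNz -[in RHS](subrK n.+1%:~R x) pern.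
exists (t - (Num.floor t)%:~R); last by rewrite -mulrNz perz.
have := Num.Theory.floor_itv t; rewrite intrD.
by move=> /andP[h1 h2]; rewrite subr_ge0 h1 /=; lra.
Qed.

End Jumps.

Theorem corollary1p2 (R : realType) (M : manifold3 R) (F : foliation M)
    (X : M -> chart R M -> 'rV[R]_3) :
  irreducible M -> rational_homology_sphere M ->
  transverse_orientation F X -> taut F ->
  ~ exists L : set M, compact_leaf F L.
Proof.
move=> _ hM oX tautF [L cL]; have hsd := @manifold_hausdorff R M.
have [[p0 L0] _] := cL; have [g lg [t1 gt1]] := tautF p0.
rewrite -L0 in gt1; have [per _ [cg _] _] := lg.
have [a a01 ga] := periodicE per t1.
pose s := mksingular (vertex0 1) (fun x : simplex R 1 => g (set_val x 0 ord_max)).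
have sg : singular_path s = g \o clamp01.
  apply/funext => t; rewrite /singular_path /s mksingularE; last exact: loop_singular_continuous.
  by rewrite /= mxE.
have c0 : clamp01 0 = 0 :> R by rewrite clamp01_id // lexx ler01.
have c1 : clamp01 1 = 1 :> R by rewrite clamp01_id // lexx ler01.
have [d ds] : null (<< s >> : chain R M 1).
  apply: rational_homology_sphere_null => //; apply: loop_boundary.
  by rewrite sg /= c0 c1 -(per 0) add0r.
pose k := crossing oX L.
have kK : cocycle k by exact: crossing_cocycle.
have [Phi [Phi0 PhiE]] := @period_linear R M k kK.
have [f fP] := primitive_exists kK (@singular_path_continuous R M s).
have [e e1 dir] := loop_direction oX lg.
have : f 1 - f 0 = 0 by rewrite -(PhiE s f fP) -ds Phi0.
suff : f 1 - f 0 != 0 by move=> /eqP.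
(* Multiplying by the direction [e] of the loop makes all jumps positive. *)
pose G t := f t * e%:~R.
suff : G 0 < G 1.
  by rewrite /G subr_eq0; apply: contraTneq => ->; rewrite ltxx.
apply: (@jumps_increasing R G (fun t => `[< L (g t) >]) a) => //; last first.
  by apply/asboolP; rewrite ga.
move=> x x01; have xI : `[0, 1]%classic x by rewrite /= in_itv.
have h1 := fP x xI; have h2 := dir x x01.
apply: filterS2 h1 h2 => y h1 h2 y01; rewrite /G h1 ?in_itv //=.
rewrite sg /= !clamp01_id // mulrDl; congr (_ + _).
have [Lx|nLx] := pselect (L (g x)).
  rewrite /k crossing_on // asboolT // h2 mulr1n mul1r -intrM -mulrA sqr_sign // mulr1.
  by [].
by rewrite /k crossing_off // asboolF // !mul0r.
Qed.
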